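(* Every $\lambda_\wp$-transducer can be converted into an equivalent 2PRFT in polynomial time.
   Context: A $\lambda_\wp$-transducer with input alphabet $\Sigma$ and output alphabet $\Gamma$ consists of purely affine planar $\lambda$-terms with constants from the signature $\underline{\Gamma}=\{a:\mathtt{o}\multimap\mathtt{o}\mid a\in\Gamma\}\cup\{\epsilon:\mathtt{o}\}$, where $\mathtt{o}$ is the base type: - an iteration type $\kappa$; - a term $d_a:\kappa\multimap\kappa$ for each $a\in\Sigma$; - a term $d_\epsilon:\kappa$; - a term $o:\kappa\multimap\mathtt{o}$. It maps $w_0\dots w_n$ to the word $v$ such that the normal form of $o\,(d_{w_n}(\dots(d_{w_0}\,d_\epsilon)))$ is $a_1(a_2(\dots(a_k\,\epsilon)))$ with $v=a_1\dots a_k$. A 2PRFT (two-way planar reversible transducer) with input $\Sigma$ and output $\Gamma$ is a functor $\mathcal{T}:\mathcal{C}_\Sigma\to\mathrm{TransDiag}_\Gamma$. - $\mathcal{C}_\Sigma$ is the category freely generated by objects $\mathrm{in},\mathrm{states},\mathrm{out}$ and arrows $\triangleright:\mathrm{in}\to\mathrm{states}$, $a:\mathrm{states}\to\mathrm{states}$ for $a\in\Sigma$, and $\triangleleft:\mathrm{states}\to\mathrm{out}$. - The functor satisfies $\mathcal{T}(\mathrm{in})=$ the empty word and $\mathcal{T}(\mathrm{out})=+-$. - It computes $w\mapsto$ the label of the unique possible edge in the diagram $\mathcal{T}(\triangleright);\mathcal{T}(w);\mathcal{T}(\triangleleft)$, or $\bot$ if that edge is absent. $\mathrm{TransDiag}_\Gamma$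 is the category whose objects are words over $\{+,-\}$ and whose morphisms are planar diagrams. Every vertex has degree at most one, edges are labelled by words of $\Gamma^*$, and each edge is orientable from an implicit source to an implicit target. Composition pastes diagrams and concatenates labels; the tensor is concatenation. Equivalent means computing the same function $\Sigma^*\to\Gamma^*$. *)

(* Defs.v *)
From mathcomp Require Import all_boot.
From Stdlib Require Import BinNums Relation_Operators.

Set Implicit Arguments.
Unset Strict Implicit.
Unset Printing Implicit Defensive.

(** * The purely affine planar lambda-calculus *)

Inductive ty : Type :=
| TyO
| TyArr of ty & ty.

Notation "A -o B" := (TyArr A B) (at level 55, right associativity).

(** Raw (Curry-style) terms over the signature with one constant [a : o -o o]
    for every letter [a : C] and the constant [epsilon : o].  Variables are
    de Bruijn indices. *)
Inductive term (C : Type) : Type :=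
| Var of nat
| Lam of term C
| App of term C & term C
| Cst of C
| Eps.

Arguments Var {C}.
Arguments Eps {C}.

Section Terms.
Variable C : Type.
Implicit Types (t u : term C) (G D : seq ty).

Fixpoint shift (d c : nat) t : term C :=
  match t with
  | Var i => Var (if i < c then i else i + d)
  | Lam t => Lam (shift d c.+1 t)
  | App t u => App (shift d c t) (shift d c u)
  | Cst a => Cst a
  | Eps => Eps
  end.

(** [subst j s t] is [t] with [s] for the variable [j] and the variables above
    [j] renumbered, as [j] disappears. *)
Fixpoint subst (j : nat) (s t : term C) : term C :=
  match t with
  | Var i => if i == j then shift j 0 s else Var (if j < i then i.-1 else i)
  | Lam t => Lam (subst j.+1 s t)
  | App t u => App (subst j s t) (subst j s u)
  | Cst a => Cst a
  | Eps => Eps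
  end.

(** Contexts list the innermost (rightmost) variable first, so that the ordered
    context written "G, D" on paper is [D ++ G].  The rules are
<<
                              G, x : A |- t : B      G |- t : A -o B   D |- u : A
    ---------------------    --------------------    -----------------------------
     G, x : A, D |- x : A    G |- \x. t : A -o B           G, D |- t u : B
>>
    There is no exchange and no contraction; weakening is absorbed by the
    axioms.  In the application rule [t] is shifted past the variables of [D]. *)
Inductive typed : seq ty -> term C -> ty -> Prop :=
| typed_var G i A : onth G i = Some A -> typed G (Var i) A
| typed_lam G t A B : typed (A :: G) t B -> typed G (Lam t) (A -o B)
| typed_app G D t u A B :
    typed G t (A -o B) -> typed D u A ->
    typed (D ++ G) (App (shift (size D) 0 t) u) B
| typed_cst G a : typed G (Cst a) (TyO -o TyO)
| typed_eps G : typed G Eps TyO.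

Inductive beta : term C -> term C -> Prop :=
| beta_redex t u : beta (App (Lam t) u) (subst 0 u t)
| beta_lam t t' : beta t t' -> beta (Lam t) (Lam t')
| beta_appl t t' u : beta t t' -> beta (App t u) (App t' u)
| beta_appr t u u' : beta u u' -> beta (App t u) (App t u').

Definition normal_form_of t u : Prop :=
  clos_refl_trans _ beta t u /\ forall u', ~ beta u u'.

Definition term_of_word (v : seq C) : term C :=
  foldr (fun a t => App (Cst a) t) Eps v.

End Terms.

(** * Lambda-transducers *)

Record lam_transducer (Sigma Gamma : finType) : Type := LamTransducer {
  lt_ty : ty;
  lt_step : Sigma -> term Gamma;
  lt_init : term Gamma;
  lt_out : term Gamma;
  lt_stepP : forall a, typed [::] (lt_step a) (lt_ty -o lt_ty);
  lt_initP : typed [::] lt_init lt_ty;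
  lt_outP : typed [::] lt_out (lt_ty -o TyO)
}.

(** The term [o (d_wn (... (d_w0 d_epsilon)))]: the first letter is innermost. *)
Definition lt_run (Sigma Gamma : finType) (T : lam_transducer Sigma Gamma)
    (w : seq Sigma) : term Gamma :=
  App (lt_out T) (foldl (fun t a => App (lt_step T a) t) (lt_init T) w).

Definition lt_maps (Sigma Gamma : finType) (T : lam_transducer Sigma Gamma)
    (w : seq Sigma) (v : seq Gamma) : Prop :=
  normal_form_of (lt_run T w) (term_of_word v).

(** * Planar diagrams *)

Inductive sign : Type := Plus | Minus.

Definition is_plus (s : sign) : bool := if s is Plus then true else false.

Section Diagrams.
Variable Gamma : finType.

(** The vertices of a diagram [u -> v]: [inl] for the letters of the domain,
    [inr] for those of the codomain. *)
Definition vertex (u v : seq sign) : Type := ('I_(size u) + 'I_(size v))%type.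

(** An edge enters a diagram at a [+] of its domain or at a [-] of its codomain;
    all the other vertices can only be targets. *)
Definition is_source u v (p : vertex u v) : bool :=
  match p with
  | inl i => is_plus (nth Plus u i)
  | inr j => ~~ is_plus (nth Plus v j)
  end.

(** Position on the boundary of the strip: the domain from left to right, then
    the codomain from right to left. *)
Definition position u v (p : vertex u v) : nat :=
  match p with
  | inl i => i
  | inr j => size u + (size v - j.+1)
  end.

Definition between (a b c : nat) : bool := minn a b < c < maxn a b.

(** [D p = Some (q, l)] means that there is an edge from [p] to [q] with
    label [l]. *)
Definition diag (u v : seq sign) : Type :=
  {ffun vertex u v -> option (vertex u v * seq Gamma)}.

Definition edge u v (D : diag u v) (p q : vertex u v) : Prop :=
  exists l, D p = Some (q, l).

Definition well_oriented u v (D : diag u v) : Prop :=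
  forall p q, edge D p q -> is_source p /\ ~~ is_source q.

(** With [well_oriented], this says that every vertex has degree at most one. *)
Definition edge_injective u v (D : diag u v) : Prop :=
  forall p p' q, edge D p q -> edge D p' q -> p = p'.

(** No two edges cross: the ends of one are on the same side of the other. *)
Definition planar u v (D : diag u v) : Prop :=
  forall p q p' q', edge D p q -> edge D p' q' ->
    between (position p) (position q) (position p') =
    between (position p) (position q) (position q').

Record transdiag (u v : seq sign) : Type := TransDiag {
  td_diag :> diag u v;
  td_oriented : well_oriented td_diag;
  td_injective : edge_injective td_diag;
  td_planar : planar td_diag
}.

Definition diag_id (u : seq sign) : diag u u :=
  [ffun p : vertex u u => match p with
   | inl i => if is_plus (nth Plus u i) then Some (inr i, [::]) else None
   | inr i => if is_plus (nth Plus u i) then None else Some (inl i, [::])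
   end].

(** The path that has reached the letter [k] of the middle word [v], with label
    [l] so far, goes on in the diagram for which [k] is a source.  A path from
    a source of the composite never meets a middle letter twice, so [size v]
    is enough fuel.  A path that stops in the middle yields no edge, and closed
    loops are never visited. *)
Fixpoint follow u v w (f : diag u v) (g : diag v w) (n : nat)
    (k : 'I_(size v)) (l : seq Gamma) : option (vertex u w * seq Gamma) :=
  if n isn't n'.+1 then None else
  if is_plus (nth Plus v k) then
    match g (inl k) with
    | Some (inl k', l') => follow f g n' k' (l ++ l')
    | Some (inr j, l') => Some (inr j, l ++ l')
    | None => None
    end
  else
    match f (inr k) with
    | Some (inl i, l') => Some (inl i, l ++ l')
    | Some (inr k', l') => follow f g n' k' (l ++ l')
    | None => None
    end.

(** Composition in diagrammatic order: [f ; g]. *)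
Definition diag_comp u v w (f : diag u v) (g : diag v w) : diag u w :=
  [ffun p : vertex u w => match p with
   | inl i =>
       match f (inl i) with
       | Some (inl i', l) => Some (inl i', l)
       | Some (inr k, l) => follow f g (size v) k l
       | None => None
       end
   | inr j =>
       match g (inr j) with
       | Some (inl k, l) => follow f g (size v) k l
       | Some (inr j', l) => Some (inr j', l)
       | None => None
       end
   end].

End Diagrams.

(** * Two-way planar reversible transducers *)

(** A functor from a freely generated category is the choice of the images of
    the generators; [in] is sent to the empty word and [out] to [+-]. *)
Record prft (Sigma Gamma : finType) : Type := PRFT {
  prft_states : seq sign;
  prft_left : transdiag Gamma [::] prft_states;
  prft_letter : Sigma -> transdiag Gamma prft_states prft_states;
  prft_right : transdiag Gamma prft_states [:: Plus; Minus]
}.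

Definition prft_word (Sigma Gamma : finType) (T : prft Sigma Gamma)
    (w : seq Sigma) : diag Gamma (prft_states T) (prft_states T) :=
  foldl (fun D a => diag_comp D (prft_letter T a))
    (diag_id Gamma (prft_states T)) w.

Definition prft_diag (Sigma Gamma : finType) (T : prft Sigma Gamma)
    (w : seq Sigma) : diag Gamma [::] [:: Plus; Minus] :=
  diag_comp (diag_comp (prft_left T) (prft_word T w)) (prft_right T).

(** The only possible source of an edge is the letter [-] of the codomain. *)
Definition prft_out (Sigma Gamma : finType) (T : prft Sigma Gamma)
    (w : seq Sigma) : option (seq Gamma) :=
  omap snd (prft_diag T w (inr ord_max)).

(** The two machines compute the same function [Sigma^* -> Gamma^*]. *)
Definition equivalent (Sigma Gamma : finType)
    (T : lam_transducer Sigma Gamma) (T' : prft Sigma Gamma) : Prop :=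
  exists f : seq Sigma -> seq Gamma,
    (forall w v, lt_maps T w v <-> v = f w) /\
    (forall w, prft_out T' w = Some (f w)).

(** * Polynomial time *)

(** First-order functional programs over binary trees, with eager evaluation
    (in the style of Jones, "Computability and Complexity", MIT Press 1997).
    The program is a list of function bodies, each with one argument.
    Evaluating an expression costs the size of its value plus the costs of its
    immediate evaluations: charging the size, rather than a unit, keeps every
    value that is built (sharing included) of size at most the cost, so that
    this time is polynomially related to that of Turing machines. *)
Inductive tree : Type :=
| Leaf
| Node of tree & tree.

Fixpoint tree_size (x : tree) : nat :=
  if x is Node y z then (tree_size y + tree_size z).+1 else 1.

Inductive expr : Type :=
| EVar of nat
| ELeaf
| ENode of expr & expr
| ECase of expr & expr & expr
| ECall of nat & expr.

Definition program : Type := seq expr.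

(** [eval P env e x c]: in the environment [env], the expression [e] has value
    [x] and its evaluation costs [c].  The second branch of a case distinction
    has the two subtrees of the scrutinee as variables 0 and 1. *)
Inductive eval (P : program) : seq tree -> expr -> tree -> nat -> Prop :=
| eval_var env i : eval P env (EVar i) (nth Leaf env i)
    (tree_size (nth Leaf env i))
| eval_leaf env : eval P env ELeaf Leaf 1
| eval_node env e1 e2 x1 x2 c1 c2 :
    eval P env e1 x1 c1 -> eval P env e2 x2 c2 ->
    eval P env (ENode e1 e2) (Node x1 x2) (tree_size (Node x1 x2) + c1 + c2)
| eval_case_leaf env e e1 e2 x c c1 :
    eval P env e Leaf c -> eval P env e1 x c1 ->
    eval P env (ECase e e1 e2) x (tree_size x + c + c1)
| eval_case_node env e e1 e2 y z x c c2 :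
    eval P env e (Node y z) c -> eval P (y :: z :: env) e2 x c2 ->
    eval P env (ECase e e1 e2) x (tree_size x + c + c2)
| eval_call env f e y x c c' :
    eval P env e y c -> eval P [:: y] (nth ELeaf P f) x c' ->
    eval P env (ECall f e) x (tree_size x + c + c').

(** The function of index 0 is the main one. *)
Definition computes_in_time (P : program) (x y : tree) (n : nat) : Prop :=
  exists2 c, eval P [:: x] (nth ELeaf P 0) y c & c <= n.

(** * Transducers as inputs and outputs of programs *)

Definition code_nat (n : nat) : tree := iter n (Node Leaf) Leaf.

Definition code_seq (X : Type) (code : X -> tree) (s : seq X) : tree :=
  foldr (fun x t => Node (code x) t) Leaf s.

Definition code_option (X : Type) (code : X -> tree) (o : option X) : tree :=
  if o is Some x then Node Leaf (code x) else Leaf.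

Definition code_pair (X Y : Type) (codeX : X -> tree) (codeY : Y -> tree)
    (z : X * Y) : tree := Node (codeX z.1) (codeY z.2).

Fixpoint code_positive (p : positive) : tree :=
  match p with
  | xH => Leaf
  | xO p => Node Leaf (code_positive p)
  | xI p => Node (Node Leaf Leaf) (code_positive p)
  end.

(** A letter is the binary representation of its rank in its alphabet. *)
Definition code_letter (X : finType) (a : X) : tree :=
  if bin_of_nat (enum_rank a) is Npos p then Node Leaf (code_positive p)
  else Leaf.

Fixpoint code_ty (A : ty) : tree :=
  if A is TyArr A B then Node (code_ty A) (code_ty B) else Leaf.

(** Every term is a pair of a tag and a content.  Indices in unary are harmless:
    the index of a bound variable is smaller than the size of the term. *)
Fixpoint code_term (X : finType) (t : term X) : tree :=
  match t with
  | Var i => Node (code_nat 0) (code_nat i)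
  | Lam t => Node (code_nat 1) (code_term t)
  | App t u => Node (code_nat 2) (Node (code_term t) (code_term u))
  | Cst a => Node (code_nat 3) (code_letter a)
  | Eps => Node (code_nat 4) Leaf
  end.

Definition code_lam_transducer (Sigma Gamma : finType)
    (T : lam_transducer Sigma Gamma) : tree :=
  Node (code_ty (lt_ty T))
    (Node (code_seq (fun a => code_term (lt_step T a)) (enum Sigma))
      (Node (code_term (lt_init T)) (code_term (lt_out T)))).

Definition code_sign (s : sign) : tree :=
  if s is Plus then Leaf else Node Leaf Leaf.

Definition code_vertex u v (p : vertex u v) : tree :=
  match p with
  | inl i => Node Leaf (code_nat i)
  | inr j => Node (Node Leaf Leaf) (code_nat j)
  end.

(** The edges that start from the vertices of the domain, then those that start
    from the vertices of the codomain, both from left to right. *)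
Definition code_diag (Gamma : finType) u v (D : diag Gamma u v) : tree :=
  let code_from p :=
    code_option (code_pair (@code_vertex u v) (code_seq (@code_letter Gamma)))
      (D p) in
  Node (code_seq (fun i => code_from (inl i)) (enum 'I_(size u)))
    (code_seq (fun j => code_from (inr j)) (enum 'I_(size v))).

Definition code_prft (Sigma Gamma : finType) (T : prft Sigma Gamma) : tree :=
  Node (code_seq code_sign (prft_states T))
    (Node (code_diag (prft_left T))
      (Node (code_seq (fun a => code_diag (prft_letter T a)) (enum Sigma))
        (code_diag (prft_right T)))).

(* Main.v *)
Require Import Defs.
From mathcomp Require Import all_boot zify.
From Stdlib Require Import Relation_Operators Operators_Properties.

(* A lambda-term is read as the matching described by its eta-long normal form,
   the type [A -o B] being drawn as the word of [B] followed by the reversed dual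
   of the word of [A].  The reading is done by an abstract machine that works on
   raw terms: each variable is replaced by the place of its type in the diagram
   when it is introduced, and an affine beta-step makes the term smaller, so that
   a linear number of steps is enough.  In a planar term an abstraction binds the
   rightmost leaf, hence the leaves read from left to right follow the boundary
   of the diagram and the edges do not cross.

   For correctness, fix a graph and say that a place at type [A -o B] realizes
   [t] when [t u] is realized by its [B] part as soon as [u] is realized by its
   [A] part; at type [o], the path from [-] to [+] must carry a word to which [t]
   reduces.  A term is realized by every graph that contains its edges.  The
   graph of a composite, with the vertices of the middle word added, has the
   same paths between the old vertices, so diagrams compose as terms do, and
   confluence makes the word unique. *)

Set Implicit Arguments.
Unset Strict Implicit.
Unset Printing Implicit Defensive.

(** * Confluence of beta-reduction *)

(** The program receives raw terms without typing derivations; this is why the reading acts on raw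
    terms, and types and order only justify it. Simple typing excludes stuck states, and the order
    of the binders gives affinity and planarity.

    One weight serves three times: it is the termination measure of the reading, it bounds the
    number of steps, and it bounds the size of the edges produced. The cost of the program is then
    this number of steps times the cost of one step.

    A property of a diagram is stated in all graphs that contain the diagram, and this is what
    allows a middle word to be adjoined and each factor to be used in the larger graph. Only at the
    very end is the graph instantiated, with the final diagram itself. *)

Section Confluence.
Variable C : Type.
Implicit Types t u s : term C.

Notation betas := (clos_refl_trans (term C) (@beta C)).

(** Innermost tests are split first: a comparison whose operands still contain an [if] waits, so
    that [lia] sees plain indices. *)
Ltac var_cases := repeat (match goal with
  | |- context [if ?a <= ?b then _ else _] =>
    lazymatch constr:((a, b)) with
    | context [if _ then _ else _] => fail
    | _ => case: (leqP a b) => ?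
    end
  | |- context [if ?a == ?b then _ else _] =>
    lazymatch constr:((a, b)) with
    | context [if _ then _ else _] => fail
    | _ => case: (eqVneq a b) => ?
    end
  end; rewrite /=); try congr Var; lia.

Lemma shift_shift d d' c c' t : c' <= c <= c' + d' ->
  shift d c (shift d' c' t) = shift (d + d') c' t.
Proof.
elim: t c c' => [i|t IH|t IHt u IHu|a|] c c' h //=.
- by var_cases.
- by rewrite IH //; lia.
- by rewrite IHt // IHu.
Qed.

Lemma shiftC d d' c c' t : c' <= c ->
  shift d (c + d') (shift d' c' t) = shift d' c' (shift d c t).
Proof.
elim: t c c' => [i|t IH|t IHt u IHu|a|] c c' h //=.
- by var_cases.
- by rewrite -addSn IH.
- by rewrite IHt // IHu.
Qed.

Lemma shift_subst d c j s t :
  shift d (j + c) (subst j s t) = subst j (shift d c s) (shift d (j + c).+1 t).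
Proof.
elim: t j => [i|t IH|t IHt u IHu|a|] j //=.
- have [->|ne] := eqVneq i j.
    by rewrite ltnS leq_addr eqxx addnC shiftC.
  case: (ltnP i (j + c).+1) => hi.
    by rewrite (negPf ne) /=; var_cases.
  by var_cases.
- by rewrite -addSn IH.
- by rewrite IHt IHu.
Qed.

(** [j] is one of the [d] indices freed by the shift, so nothing is replaced and the substitution
    only narrows the gap by one. *)
Lemma subst_shift_cancel j d c s t : c <= j < c + d ->
  subst j s (shift d c t) = shift d.-1 c t.
Proof.
elim: t j c => [i|t IH|t IHt u IHu|a|] j c h //=.
- by var_cases.
- by rewrite IH //; lia.
- by rewrite IHt // IHu.
Qed.

Lemma subst_shift j d c s t : c <= j ->
  subst (j + d) s (shift d c t) = shift d c (subst j s t).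
Proof.
elim: t j c => [i|t IH|t IHt u IHu|a|] j c h //=.
- have [->|ne] := eqVneq i j.
    by rewrite ltnNge h /= eqxx shift_shift; [rewrite addnC|lia].
  by var_cases.
- by rewrite -addSn IH.
- by rewrite IHt // IHu.
Qed.

Lemma subst_subst i j s u t :
  subst (i + j) s (subst i u t) = subst i (subst j s u) (subst (i + j).+1 s t).
Proof.
elim: t i => [k|t IH|t IHt w IHw|a|] i //=.
- have [->|ne] := eqVneq k i.
    have -> : (i == (i + j).+1) = false by lia.
    have -> : ((i + j).+1 < i) = false by lia.
    by rewrite /= eqxx addnC subst_shift.
  have [->|ne'] := eqVneq k (i + j).+1.
    have -> : (i < (i + j).+1) = true by lia.
    by rewrite /= eqxx subst_shift_cancel //; lia.
  by var_cases.
- by rewrite -addSn IH.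
- by rewrite IHt IHw.
Qed.

(** Parallel reduction in the style of Tait and Martin-Lof. *)
Inductive par : term C -> term C -> Prop :=
| par_var i : par (Var i) (Var i)
| par_lam t t' : par t t' -> par (Lam t) (Lam t')
| par_app t t' u u' : par t t' -> par u u' -> par (App t u) (App t' u')
| par_cst a : par (Cst a) (Cst a)
| par_eps : par Eps Eps
| par_redex t t' u u' : par t t' -> par u u' ->
    par (App (Lam t) u) (subst 0 u' t').

Lemma par_refl t : par t t.
Proof. by elim: t; constructor. Qed.

Lemma par_shift d c t t' : par t t' -> par (shift d c t) (shift d c t').
Proof.
move=> h; elim: h c => /=; try by constructor.
move=> {}t {}t' u u' _ IHt _ IHu c.
by rewrite (shift_subst d c 0); constructor.
Qed.

Lemma par_subst j s s' t t' :
  par s s' -> par t t' -> par (subst j s t) (subst j s' t').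
Proof.
move=> hs h; elim: h j => /=; try by constructor.
- by move=> i j; case: ifP => _; [apply: par_shift|constructor].
- move=> {}t {}t' u u' _ IHt _ IHu j.
  by rewrite (subst_subst 0); constructor.
Qed.

(** Takahashi's complete development; [par_develop] is its triangle property. *)
Fixpoint develop t : term C :=
  match t with
  | Lam t => Lam (develop t)
  | App (Lam t) u => subst 0 (develop u) (develop t)
  | App t u => App (develop t) (develop u)
  | _ => t
  end.

Lemma par_develop t t' : par t t' -> par t' (develop t).
Proof.
elim=> /=; try by constructor.
- move=> {}t {}t' u u' ht IHt hu IHu.
  case: t ht IHt => [i|t|t1 t2|a|] ht IHt; try by constructor.
  by inversion ht; subst; inversion IHt; subst; constructor.
- by move=> {}t {}t' u u' _ IHt _ IHu; apply: par_subst.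
Qed.

Lemma beta_par t t' : beta t t' -> par t t'.
Proof. by elim; constructor; try apply: par_refl. Qed.

Lemma betas_lam t t' : betas t t' -> betas (Lam t) (Lam t').
Proof.
by elim; [move=> x y h; apply/rt_step/beta_lam|constructor
         |move=> x y z _ h _; apply: rt_trans].
Qed.

Lemma betas_app t t' u u' :
  betas t t' -> betas u u' -> betas (App t u) (App t' u').
Proof.
move=> ht hu; apply: (rt_trans _ _ _ (App t' u)).
  by elim: ht; [move=> x y h; apply/rt_step/beta_appl|constructor
         |move=> x y z _ h _; apply: rt_trans].
by elim: hu; [move=> x y h; apply/rt_step/beta_appr|constructor
         |move=> x y z _ h _; apply: rt_trans].
Qed.

Lemma par_betas t t' : par t t' -> betas t t'.
Proof.
elim; try by constructor.
- by move=> {}t {}t' _; apply: betas_lam.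
- by move=> {}t {}t' u u' _ ht _ hu; apply: betas_app.
- move=> {}t {}t' u u' _ ht _ hu.
  apply: (rt_trans _ _ _ (App (Lam t') u')); last exact/rt_step/beta_redex.
  by apply: betas_app => //; apply: betas_lam.
Qed.

Lemma betas_normal t u : (forall t', ~ beta t t') -> betas t u -> u = t.
Proof.
move=> nt /(clos_rt_rt1n _ _ _ _) h.
by case: h nt => // y z h _ /(_ y).
Qed.

(** The iterated developments are cofinal: a step is absorbed by one development, and [develop] is
    monotone for [betas]. *)
Lemma betas_develop t u : betas t u -> exists n, betas u (iter n develop t).
Proof.
have develop_betas x y : betas x y -> betas (develop x) (develop y).
  elim; [move=> a b h|move=> a|move=> a b c _ h1 _ h2].
  - exact/par_betas/par_develop/par_develop/beta_par.
  - exact: rt_refl.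
  - exact: rt_trans h1 h2.
move=> /(clos_rt_rtn1 _ _ _ _); elim=> [|y z hyz _ [n hn]].
  by exists 0; apply: rt_refl.
exists n.+1; apply: (rt_trans _ _ _ (develop y)); last exact: develop_betas.
exact/par_betas/par_develop/beta_par.
Qed.

(** Both normal forms are iterated developments of [t]; the longer iteration goes through the end of
    the shorter one and stays there. *)
Lemma normal_form_uniq t u v :
  normal_form_of t u -> normal_form_of t v -> u = v.
Proof.
move=> [tu nu] [tv nv].
have [[n hn] [m hm]] := (betas_develop tu, betas_develop tv).
have dev_id w : (forall t', ~ beta w t') -> forall k, iter k develop w = w.
  move=> nw; elim=> //= k ->; apply: betas_normal => //.
  exact/par_betas/par_develop/par_refl.
move: hn hm => /(betas_normal nu) hn /(betas_normal nv) hm.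
wlog le_nm : n m u v {tu tv} nu nv hn hm / n <= m.
  move=> H; case/orP: (leq_total n m) => h; first exact: (H n m).
  by apply/esym/(H m n).
by rewrite -hm -(subnK le_nm) iterD hn dev_id.
Qed.

Lemma term_of_word_normal (v : seq C) t : ~ beta (term_of_word v) t.
Proof.
elim: v t => [|a v IH] t /= h; inversion h; subst; last exact: IH H2.
by inversion H2.
Qed.

Lemma term_of_word_inj : injective (@term_of_word C).
Proof. by elim=> [|a v IH] [|b w] //= [-> /IH ->]. Qed.

End Confluence.

(** * Located types and the reading machine *)

(* The places, in a diagram, of the letters [+] and [-] of every occurrence of
   [o] in a type.  The word of [o] is [+-], that of [A -o B] is the word of [B]
   followed by the reversed dual of the word of [A]: it is always [(+-)^n]. *)
Inductive lty (V : Type) : Type :=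
| LO of V & V
| LArr of lty V & lty V.

Fixpoint lmap (V W : Type) (f : V -> W) (X : lty V) : lty W :=
  match X with
  | LO p m => LO (f p) (f m)
  | LArr X Y => LArr (lmap f X) (lmap f Y)
  end.

(* The letter [i] of the domain is [(false, i)], that of the codomain
   [(true, i)]. *)
Definition vert : Type := bool * nat.

(* A variable is replaced by [XNe X] as soon as its place [X] is known, so that
   only closed terms are substituted and nothing has to be shifted. *)
Inductive xterm (C : Type) : Type :=
| XVar of nat
| XLam of xterm C
| XApp of xterm C & xterm C
| XCst of C
| XEps
| XNe of lty vert.

Arguments XVar {C}.
Arguments XEps {C}.
Arguments XNe {C}.

Section Terms.
Variable C : eqType.
Implicit Types (t u : term C) (x y : xterm C).

Fixpoint embed t : xterm C :=
  match t with
  | Var i => XVar i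
  | Lam t => XLam (embed t)
  | App t u => XApp (embed t) (embed u)
  | Cst a => XCst a
  | Eps => XEps
  end.

Fixpoint xsubst (j : nat) (s x : xterm C) : xterm C :=
  match x with
  | XVar i => if i == j then s else XVar i
  | XLam x => XLam (xsubst j.+1 s x)
  | XApp x y => XApp (xsubst j s x) (xsubst j s y)
  | _ => x
  end.

(** The heads that wait for an argument. Applications are left out, so that they are unfolded before
    any eta-expansion. *)
Definition etable x : bool :=
  match x with XLam _ | XCst _ | XNe (LArr _ _) => true | _ => false end.

(** [(p, (q, l))] is the edge from [p] to [q] with label [l]. *)
Definition ledge : Type := (vert * (vert * seq C))%type.

(* [reads n x S X l E]: in [n] steps, the term [x] applied to the stack [S], whose
   result is at [X], yields the edges [E]; the path that enters at [X] has
   already output [l].  This eta-expands and normalizes at the same time. *)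
Inductive reads : nat -> xterm C -> seq (xterm C) -> lty vert -> seq C ->
    seq ledge -> Prop :=
| reads_app n x y S X l E :
    reads n x (y :: S) X l E -> reads n.+1 (XApp x y) S X l E
| reads_eta n x X Y l E : etable x ->
    reads n x [:: XNe X] Y l E -> reads n.+1 x [::] (LArr X Y) l E
| reads_beta n x y S X l E :
    reads n (xsubst 0 y x) S X l E -> reads n.+1 (XLam x) (y :: S) X l E
| reads_cst n a y p m l E :
    reads n y [::] (LO p m) (rcons l a) E ->
    reads n.+1 (XCst a) [:: y] (LO p m) l E
| reads_eps p m l : reads 1 XEps [::] (LO p m) l [:: (m, (p, l))]
| reads_ne n n' y Y1 Y2 S X l E E' :
    reads n y [::] Y1 [::] E -> reads n' (XNe Y2) S X l E' ->
    reads (n + n').+1 (XNe (LArr Y1 Y2)) (y :: S) X l (E ++ E')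
| reads_ne0 p' m' p m l :
    reads 1 (XNe (LO p' m')) [::] (LO p m) l
      [:: (m, (m', l)); (p', (p, [::]))].

Fixpoint closed_at (k : nat) t : bool :=
  match t with
  | Var i => i < k
  | Lam t => closed_at k.+1 t
  | App t u => closed_at k t && closed_at k u
  | _ => true
  end.

Lemma shift_closed d c t : closed_at c t -> shift d c t = t.
Proof.
elim: t c => [i|t IH|t IHt u IHu|a|] c //=; first by move->.
  by move/IH->.
by case/andP=> /IHt-> /IHu->.
Qed.

Lemma closed_at_shift k d c t :
  closed_at k t -> closed_at (k + d) (shift d c t).
Proof.
elim: t k c => [i|t IH|t IHt u IHu|a|] k c //=.
- by case: ifP; lia.
- by move/IH; rewrite addSn; apply.
- by case/andP=> /IHt-> /IHu->.
Qed.

Lemma closed_atW k k' t : k <= k' -> closed_at k t -> closed_at k' t.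
Proof.
elim: t k k' => [i|t IH|t IHt u IHu|a|] k k' h //=.
- by move=> hi; apply: leq_trans hi h.
- exact: IH.
- by case/andP=> /(IHt _ _ h)-> /(IHu _ _ h).
Qed.

Lemma typed_closed_at G t A : typed G t A -> closed_at (size G) t.
Proof.
elim=> //= [{}G i {}A|G' D {}t u A' B _ IHt _ IHu].
  by rewrite -onthTE => ->.
rewrite size_cat addnC closed_at_shift // (closed_atW _ IHu) ?leq_addl //.
Qed.

Notation betas := (clos_refl_trans (term C) (@beta C)).

(** * Realizability in a labelled graph, and soundness of the reading *)

Section Realizability.
Variables (W : Type) (R : W -> seq C -> W -> Prop).

(* Realizability in one fixed graph, with reachability [R]: an argument is
   realized by the part of the graph that is plugged there, hence no composition
   of strategies is needed.  [l] is output before the graph is entered at [X]. *)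
Fixpoint real (l : seq C) (X : lty W) t : Prop :=
  match X with
  | LO p m => exists2 v, R m (l ++ v) p & betas t (term_of_word v)
  | LArr X Y => forall u, closed_at 0 u -> real [::] X u -> real l Y (App t u)
  end.

Lemma real_expand l X t t' : betas t t' -> real l X t' -> real l X t.
Proof.
elim: X t t' => [p m|X _ Y IH] t t' h /=.
  by case=> v hR hv; exists v => //; apply: rt_trans hv.
move=> ht u cu hu; apply: (IH _ (App t' u)); last exact: ht.
by apply: betas_app => //; apply: rt_refl.
Qed.

End Realizability.

(** Moving the places along [e] amounts to pulling the graph back along [e]; a reading, whose places
    are in [vert], can thus be interpreted in any graph. *)
Lemma real_lmap (V W : Type) (R : W -> seq C -> W -> Prop) (e : V -> W) l X t :
  real R l (lmap e X) t <-> real (fun p l q => R (e p) l (e q)) l X t.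
Proof.
elim: X l t => [p m|X IHX Y IHY] l t //=.
by split=> h u cu hu; apply/IHY/h => //; apply/IHX.
Qed.

Record labelled_preorder (W : Type) (R : W -> seq C -> W -> Prop) : Prop :=
  LabelledPreorder {
    lp_refl : forall p, R p [::] p;
    lp_trans : forall p l q l' r, R p l q -> R q l' r -> R p (l ++ l') r
  }.

Section Soundness.
Variable R : vert -> seq C -> vert -> Prop.
Hypothesis preR : labelled_preorder R.

(** The ordinary term [t] is [x] with each place replaced by a closed term that this place
    realizes. *)
Inductive inst : xterm C -> term C -> Prop :=
| inst_var i : inst (XVar i) (Var i)
| inst_lam x t : inst x t -> inst (XLam x) (Lam t)
| inst_app x t y u : inst x t -> inst y u -> inst (XApp x y) (App t u)
| inst_cst a : inst (XCst a) (Cst a)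
| inst_eps : inst XEps Eps
| inst_ne X t : closed_at 0 t -> real R [::] X t -> inst (XNe X) t.

Lemma inst_embed t : inst (embed t) t.
Proof. by elim: t; constructor. Qed.

Lemma subst_closed j s t : closed_at j t -> subst j s t = t.
Proof.
elim: t j => [i|t IH|t IHt u IHu|a|] j //=.
- by move=> h; rewrite ltnNge ltnW // ltn_eqF.
- by move/IH->.
- by case/andP=> /IHt-> /IHu->.
Qed.

Lemma inst_subst j x t y u : inst x t -> closed_at j.+1 t ->
  inst y u -> closed_at 0 u -> inst (xsubst j y x) (subst j u t).
Proof.
move=> h; elim: h j => {x t} /=.
- move=> i j hi hy cu; case: eqP => [_|]; first by rewrite shift_closed.
  by have -> : (j < i) = false; [lia|constructor].
- by move=> x t _ IH j ct hy cu; constructor; apply: IH.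
- move=> x t y' u' _ IHx _ IHy j /andP[ct cu'] hy cu.
  by constructor; [apply: IHx|apply: IHy].
- by constructor.
- by constructor.
- move=> X t ct hX j _ _ _; rewrite subst_closed ?(closed_atW _ ct) //.
  by constructor.
Qed.

Lemma closed_at_subst j s t : closed_at j.+1 t -> closed_at 0 s ->
  closed_at j (subst j s t).
Proof.
move=> ht hs; elim: t j ht => [i|t IH|t IHt u IHu|a|] j //=.
- move=> hi; case: eqP => [_|/eqP ne].
    by rewrite shift_closed // (closed_atW _ hs).
  by have -> : (j < i) = false; rewrite /=; lia.
- exact: IH.
- by case/andP=> /IHt-> /IHu->.
Qed.

(** [t'] is [t] applied to closed instances of the stack. *)
Inductive insts : seq (xterm C) -> term C -> term C -> Prop :=
| insts_nil t : insts [::] t t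
| insts_cons y u S t t' : inst y u -> closed_at 0 u ->
    insts S (App t u) t' -> insts (y :: S) t t'.

Lemma insts_betas S t t1 t' : betas t t1 -> insts S t t' ->
  exists2 t2, insts S t1 t2 & betas t' t2.
Proof.
move=> ht h; elim: h t1 ht => {S t t'} [t|y u S t t' hy cu _ IH] t1 ht.
  by exists t1 => //; constructor.
have [|t2 h2 b2] := IH (App t1 u).
  by apply: betas_app => //; apply: rt_refl.
by exists t2 => //; econstructor; eauto.
Qed.

(** Eta-expansion introduces an argument known by its place alone, which [inst_ne] accepts; at
    [reads_ne] the argument, realized thanks to the first run, is given to the arrow clause of the
    head. *)
Lemma reads_sound n x S X l E : reads n x S X l E ->
  (forall p q l', (p, (q, l')) \in E -> R p l' q) ->
  forall t t', inst x t -> closed_at 0 t -> insts S t t' -> real R l X t'.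
Proof.
elim=> {n x S X l E}.
- move=> n x y S X l E _ IH hE t t' hx ct hS; inversion hx; subst.
  case/andP: ct => ct cu.
  by apply: IH (hE) _ _ _ ct _ => //; econstructor; eauto.
- move=> n x X Y l E _ _ IH hE t t' hx ct hS; inversion hS; subst => u cu hu.
  apply: IH hE _ _ hx ct _; apply: insts_cons (insts_nil _) => //.
  exact: inst_ne.
- move=> n x y S X l E _ IH hE t t' hx ct hS.
  inversion hx as [|? t0 hx0| | | |]; subst.
  inversion hS as [|? u ? ? ? hy cu hS']; subst.
  have [t2 h2 b2] := insts_betas (rt_step _ _ _ _ (beta_redex t0 u)) hS'.
  refine (real_expand b2 _); refine (IH hE _ _ _ _ h2).
    exact: inst_subst.
  exact: closed_at_subst.
- move=> n a y p m l E _ IH hE t t' hx ct hS.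
  inversion hx; subst; inversion hS as [|? u ? ? ? hy cu hS']; subst.
  inversion hS'; subst.
  have [v hR hv] := IH hE _ _ hy cu (insts_nil u).
  exists (a :: v); first by rewrite -cat_rcons.
  by apply: (@betas_app _ (Cst a)) => //; apply: rt_refl.
- move=> p m l hE t t' hx ct hS; inversion hx; subst; inversion hS; subst.
  exists [::]; last exact: rt_refl.
  by rewrite cats0; apply: hE; rewrite inE.
- move=> n n' y Y1 Y2 S X l E E' _ IH1 _ IH2 hE t t' hx ct hS.
  inversion hx as [| | | | |? ? _ hr]; subst.
  inversion hS as [|? u ? ? ? hy cu hS']; subst.
  apply: IH2 hS'.
  + by move=> p q l' hp; apply: hE; rewrite mem_cat hp orbT.
  + constructor; first by rewrite /= ct.
    apply: hr => //; apply: IH1 (insts_nil u) => // p q l' hp.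
    by apply: hE; rewrite mem_cat hp.
  + by rewrite /= ct.
- move=> p' m' p m l hE t t' hx ct hS.
  inversion hx as [| | | | |? ? _ hr]; subst; inversion hS; subst.
  case: hr => v hR hv.
  (* The path from [m] enters the place of the variable at [m'], crosses the graph to [p'] as the
     realizability of [t] promises, and returns to [p]. *)
  exists v => //; have h1 : R m l m' by apply: hE; rewrite inE eqxx.
  have h2 : R p' [::] p by apply: hE; rewrite !inE eqxx orbT.
  rewrite -[l ++ v]cats0; apply: (lp_trans preR) h2.
  exact: (lp_trans preR) h1 hR.
Qed.

End Soundness.
End Terms.

(** * Typing and planarity *)

Fixpoint lty_ty (V : Type) (X : lty V) : ty :=
  if X is LArr X Y then lty_ty X -o lty_ty Y else TyO.

Section Planarity.
Variable C : finType.
Implicit Types (t u : term C) (x y : xterm C).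

(** Plain simple typing with shared contexts: order and affinity are kept apart in [xplanar], so
    that substitution never has to split a context. *)
Inductive xtyped : seq ty -> xterm C -> ty -> Prop :=
| xtyped_var G i A : onth G i = Some A -> xtyped G (XVar i) A
| xtyped_lam G x A B : xtyped (A :: G) x B -> xtyped G (XLam x) (A -o B)
| xtyped_app G x y A B :
    xtyped G x (A -o B) -> xtyped G y A -> xtyped G (XApp x y) B
| xtyped_cst G a : xtyped G (XCst a) (TyO -o TyO)
| xtyped_eps G : xtyped G XEps TyO
| xtyped_ne G X : xtyped G (XNe X) (lty_ty X).

Definition leaf : Type := (nat + lty vert)%type.

Definition down1 (z : leaf) : option leaf :=
  match z with
  | inl i => if i is i'.+1 then Some (inl i') else None
  | inr X => Some (inr X)
  end.

Fixpoint leaves x : seq leaf :=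
  match x with
  | XVar i => [:: inl i]
  | XLam x => pmap down1 (leaves x)
  | XApp x y => leaves x ++ leaves y
  | XCst _ | XEps => [::]
  | XNe X => [:: inr X]
  end.

Definition is_var (j : nat) (z : leaf) : bool :=
  if z is inl i then i == j else false.

Definition is_ne (z : leaf) : bool := if z is inr _ then true else false.

(* An ordered abstraction binds the rightmost leaf of its body, or nothing. *)
Definition last_only (s : seq leaf) : Prop :=
  exists s', ~~ has (is_var 0) s' /\ (s = s' \/ s = rcons s' (inl 0)).

Fixpoint xplanar x : Prop :=
  match x with
  | XLam x => last_only (leaves x) /\ xplanar x
  | XApp x y => xplanar x /\ xplanar y
  | _ => True
  end.

Definition xclosed x : bool := all is_ne (leaves x).

Definition leaf_subst (j : nat) (s r : seq leaf) : seq leaf :=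
  flatten [seq if is_var j z then s else [:: z] | z <- r].

Lemma pmap_down1_ne (s : seq leaf) : all is_ne s -> pmap down1 s = s.
Proof. by elim: s => [|[i|X] s IH] //= h; rewrite IH. Qed.

Lemma pmap_down1_subst j s r : all is_ne s ->
  pmap down1 (leaf_subst j.+1 s r) = leaf_subst j s (pmap down1 r).
Proof.
move=> hs; rewrite /leaf_subst.
elim: r => [|[[|i]|X] r IH] //=; last by rewrite IH.
rewrite eqSS; case: eqP => _; last by rewrite /= IH.
by rewrite pmap_cat IH pmap_down1_ne.
Qed.

Lemma leaves_subst j y x : xclosed y ->
  leaves (xsubst j y x) = leaf_subst j (leaves y) (leaves x).
Proof.
move=> cy; elim: x j => [i|x IH|x IHx z IHz|a||X] j //=.
- by rewrite /leaf_subst /=; case: eqP => _; rewrite ?cats0.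
- by rewrite IH pmap_down1_subst.
- by rewrite IHx IHz /leaf_subst map_cat flatten_cat.
Qed.

Lemma has_leaf_subst j s r : all is_ne s ->
  has (is_var 0) (leaf_subst j.+1 s r) = has (is_var 0) r.
Proof.
move=> hs; have h0 : has (is_var 0) s = false.
  by elim: s hs => [|[i|X] s IH] //=.
rewrite /leaf_subst; elim: r => [|[[|i]|X] r IH] //=.
by case: (_ == _); rewrite ?has_cat /= ?h0 IH.
Qed.

(** The leaves of the closed term [y] are places, never a bound variable, so each abstraction of [x]
    still binds its last leaf or nothing. *)
Lemma xplanar_subst j y x : xclosed y -> xplanar y -> xplanar x ->
  xplanar (xsubst j y x).
Proof.
move=> cy py; elim: x j => [i|x IH|x IHx z IHz|a||X] j //=.
- by case: eqP.
- case=> [[s [hs e]] px]; split; last exact: IH.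
  rewrite leaves_subst //.
  exists (leaf_subst j.+1 (leaves y) s); rewrite has_leaf_subst //; split=> //.
  case: e => ->; [by left|right].
  by rewrite /leaf_subst map_rcons flatten_rcons cats1.
- by case=> px pz; split; auto.
Qed.

Lemma leaf_subst_id j s r : ~~ has (is_var j) r -> leaf_subst j s r = r.
Proof.
by rewrite /leaf_subst; elim: r => [|z r IH] //=; case: ifP => //= _ /IH->.
Qed.

Lemma pmap_down1_lam s : ~~ has (is_var 0) s -> all is_ne (pmap down1 s) ->
  all is_ne s /\ pmap down1 s = s.
Proof. by elim: s => [|[[|i]|X] s IH] //= h /(IH h)[-> ->]. Qed.

(* A redex consumes its binder at the right end of the leaves of the body,
   which is where the leaves of the argument are. *)
Lemma leaves_beta x y : xclosed (XLam x) -> xplanar (XLam x) -> xclosed y ->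
  leaves (xsubst 0 y x) = leaves (XLam x) ++ leaves y \/
  leaves (xsubst 0 y x) = leaves (XLam x).
Proof.
rewrite /xclosed /= => cx [[s [hs e]] _] cy; rewrite leaves_subst //.
case: e cx => ->.
  by case/(pmap_down1_lam hs) => _ ->; rewrite leaf_subst_id //; right.
rewrite -cats1 pmap_cat /= cats0; case/(pmap_down1_lam hs) => _ ->; left.
by rewrite /leaf_subst map_cat flatten_cat /= cats0 -/(leaf_subst _ _ _)
  leaf_subst_id.
Qed.

Lemma xclosed_beta x y : xclosed (XLam x) -> xplanar (XLam x) -> xclosed y ->
  xclosed (xsubst 0 y x).
Proof.
move=> cx px cy; rewrite /xclosed.
by case: (leaves_beta cx px cy) => -> //; rewrite all_cat; apply/andP.
Qed.

Lemma xplanar_beta x y : xclosed y -> xplanar (XLam x) -> xplanar y ->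
  xplanar (xsubst 0 y x).
Proof. by move=> cy [_ px] py; apply: xplanar_subst. Qed.

Lemma xtyped_weaken G G' x A : xtyped G x A -> xtyped (G ++ G') x A.
Proof.
elim=> {G x A}; try by econstructor; eauto.
move=> G i A h; constructor; move: h; rewrite !onthE map_cat nth_cat size_map.
case: ltnP => // h; rewrite nth_default ?size_map //.
Qed.

(** The replaced variable is the outermost one, of index [size G]: the others keep their indices, as
    [xsubst] does not renumber. *)
Lemma xtyped_subst G A x B y : xtyped (rcons G A) x B -> xtyped [::] y A ->
  xtyped G (xsubst (size G) y x) B.
Proof.
move: {-2}(rcons G A) (erefl (rcons G A)) => G' e h; elim: h G e => {G' x B} /=.
- move=> G' i B + G e hy; rewrite {}e onthE map_rcons nth_rcons size_map.
  case: ltngtP => // hi; last by case=> <-; apply: (xtyped_weaken G hy).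
  by move=> h; constructor; rewrite onthE.
- by move=> G' x A' B _ IH G e hy; constructor; apply: (IH (A' :: G)) hy; rewrite e.
- move=> G' x z A' B _ IHx _ IHz G e hy.
  by econstructor; [apply: IHx|apply: IHz].
- by constructor.
- by constructor.
- by constructor.
Qed.

Lemma embed_shift_typed X D G t A : xtyped (X ++ G) (embed t) A ->
  xtyped (X ++ D ++ G) (embed (shift (size D) (size X) t)) A.
Proof.
elim: t X A => [i|t IH|t IHt u IHu|a|] X A /= h; inversion h; subst.
- constructor; move: H1; rewrite !onthE !map_cat !nth_cat !size_map.
  case: ltnP => hi; first by rewrite hi.
  rewrite ltnNge (leq_trans hi (leq_addr _ _)) /=.
  have -> : (i + size D - size X < size D) = false by lia.
  by congr (nth _ _ _ = _); lia.
- by constructor; apply: (IH (A0 :: X)).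
- by econstructor; [apply: IHt|apply: IHu]; eassumption.
- by constructor.
- by constructor.
Qed.

Definition leaf_shift (d c : nat) (z : leaf) : leaf :=
  match z with
  | inl i => inl (if i < c then i else i + d)
  | inr X => inr X
  end.

Lemma leaves_shift d c t :
  leaves (embed (shift d c t)) = map (leaf_shift d c) (leaves (embed t)).
Proof.
elim: t c => [i|t IH|t IHt u IHu|a|] c //=; last by rewrite IHt IHu map_cat.
rewrite IH; elim: (leaves _) => [|[[|i]|X] s IHs] //=; last by rewrite IHs.
rewrite ltnS IHs; by case: ltnP.
Qed.

Lemma xplanar_shift d c t : xplanar (embed t) -> xplanar (embed (shift d c t)).
Proof.
elim: t c => [i|t IH|t IHt u IHu|a|] c //=.
  case=> [[s [hs e]] pt]; split; last exact: IH.
  rewrite leaves_shift; exists (map (leaf_shift d c.+1) s); split.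
    rewrite has_map; apply: contra hs; apply: sub_has => -[i|X] //=.
    by case: ltnP; lia.
  by case: e => ->; [left|right; rewrite map_rcons].
by case=> pt pu; split; auto.
Qed.

(** In a strictly decreasing list of indices, 0 can only come last; removing it and lowering the
    rest gives a decreasing list again. *)
Lemma pmap_down1_sorted (s : seq nat) : sorted gtn s ->
  last_only [seq inl i | i <- s] /\
  exists2 s', pmap down1 [seq inl i | i <- s] = [seq inl i | i <- s'] :> seq leaf
    & sorted gtn s' /\ {in s', forall i, i.+1 \in s}.
Proof.
case/lastP: s => [|s k].
  by split; [exists [::]; split=> //; left|exists [::]].
rewrite (sorted_pairwise (rev_trans ltn_trans)) pairwise_rcons.
case/andP=> /allP /= hk hs.
have [r er] : exists r, s = map S r.
  exists (map predn s); rewrite -map_comp -[LHS]map_id.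
  by apply/eq_in_map => i /hk /= h; rewrite prednK //; lia.
have e0 : pmap down1 [seq inl i | i <- s] = [seq inl i | i <- r] :> seq leaf.
  by rewrite er; elim: {s hk hs er} r => //= i r ->.
have hr : sorted gtn r.
  rewrite (sorted_pairwise (rev_trans ltn_trans)).
  by move: hs; rewrite er pairwise_map.
have n0 : ~~ has (is_var 0) [seq inl i | i <- s].
  rewrite has_map; apply/hasPn => i /hk /=; lia.
rewrite !map_rcons -!cats1 !pmap_cat e0; case: k hk => [|k] hk /=.
  split; first by exists [seq inl i | i <- s]; rewrite n0 -cats1; split=> //; right.
  exists r; rewrite ?cats0 //; split=> // i hi.
  by rewrite mem_cat er mem_map ?hi //; apply: succn_inj.
split.
  exists ([seq inl i | i <- s] ++ [:: inl k.+1]); split; last by left.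
  by rewrite has_cat negb_or n0.
exists (rcons r k); first by rewrite map_rcons cats1.
split.
  rewrite (sorted_pairwise (rev_trans ltn_trans)) pairwise_rcons.
  rewrite -(sorted_pairwise (rev_trans ltn_trans)) hr andbT.
  apply/allP => i hi /=.
  by have := hk i.+1; rewrite er (mem_map succn_inj) => /(_ hi).
move=> i; rewrite mem_rcons mem_cat inE => /orP[/eqP->|hi].
  by rewrite inE eqxx orbT.
by rewrite er mem_map ?hi //; apply: succn_inj.
Qed.

(** Without exchange, the indices of the leaves strictly decrease from left to right. In an
    application the leaves of the function are shifted to [size D] or more while those of the
    argument stay below [size D], hence the bound by [size G] in the induction. *)
Lemma typed_embed G t A : typed G t A ->
  [/\ xtyped G (embed t) A, xplanar (embed t) &
    exists2 s, leaves (embed t) = [seq inl i | i <- s] &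
      sorted gtn s /\ {in s, forall i, i < size G}].
Proof.
elim=> {G t A} /=.
- move=> G i A h; split; [by constructor|by []|exists [:: i]] => //; split=> // j.
  by rewrite inE => /eqP->; rewrite -onthTE h.
- move=> G t A B _ [ht pt [s e [hs bs]]].
  have [hl [s' e' [hs' bs']]] := pmap_down1_sorted hs.
  split; first by constructor.
    by rewrite e.
  exists s'; first by rewrite e.
  by split=> // i /bs' /bs.
- move=> G D t u A B _ [ht pt [s e [hs bs]]] _ [hu pu [r e' [hr br]]].
  split.
  + econstructor; first exact: (@embed_shift_typed [::]) ht.
    exact: xtyped_weaken.
  + by split=> //; apply: xplanar_shift.
  exists (map (addn (size D)) s ++ r).
    rewrite leaves_shift e e' map_cat -!map_comp; congr (_ ++ _).
    by apply: eq_map => i /=; rewrite addnC.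
  split.
    move: hs hr; rewrite !(sorted_pairwise (rev_trans ltn_trans)).
    rewrite pairwise_cat pairwise_map => hs ->; rewrite andbT; apply/andP; split.
      apply/allrelP => _ j /mapP[i _ ->] /br /=; lia.
    by apply: sub_pairwise hs => i j /=; rewrite ltn_add2l.
  move=> i; rewrite mem_cat size_cat => /orP[/mapP[j /bs h ->]|/br]; lia.
- by move=> G a; split; [constructor| |exists [::]].
- by move=> G; split; [constructor| |exists [::]].
Qed.

Lemma typed_embed_closed t A : typed [::] t A ->
  [/\ xtyped [::] (embed t) A, xplanar (embed t) & leaves (embed t) = [::]].
Proof.
case/typed_embed=> ht pt [[|i s] e [_ bs]] //.
by have := bs i; rewrite inE eqxx => /(_ isT).
Qed.

End Planarity.

(** * Termination of the reading machine *)

Definition code_tag (b : bool) : tree := if b then Node Leaf Leaf else Leaf.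

Definition code_vert (v : vert) : tree := Node (code_tag v.1) (code_nat v.2).

Fixpoint code_lty (X : lty vert) : tree :=
  match X with
  | LO p m => Node Leaf (Node (code_vert p) (code_vert m))
  | LArr X Y => Node (Node Leaf Leaf) (Node (code_lty X) (code_lty Y))
  end.

Section Weights.
Variable C : finType.
Implicit Types (t u : term C) (x y : xterm C) (S : seq (xterm C)) (l : seq C).

Fixpoint code_xterm x : tree :=
  match x with
  | XVar i => Node (code_nat 0) (code_nat i)
  | XLam x => Node (code_nat 1) (code_xterm x)
  | XApp x y => Node (code_nat 2) (Node (code_xterm x) (code_xterm y))
  | XCst a => Node (code_nat 3) (code_letter a)
  | XEps => Node (code_nat 4) Leaf
  | XNe X => Node (code_nat 5) (code_lty X)
  end.

Lemma code_embed t : code_xterm (embed t) = code_term t.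
Proof. by elim: t => [i|t IH|t IHt u IHu|a|] //=; rewrite ?IH ?IHt ?IHu. Qed.

(* The constants make the weight decrease along the rules of [reads], and bound
   the sizes of the codes of a task and of its edges. *)
Fixpoint wlty (X : lty vert) : nat :=
  match X with
  | LO p m => tree_size (code_vert p) + tree_size (code_vert m) + 5
  | LArr X Y => wlty X + wlty Y + 20
  end.

Fixpoint wterm x : nat :=
  match x with
  | XVar i => tree_size (code_nat i) + 2
  | XLam x => wterm x + 10
  | XApp x y => wterm x + wterm y + 10
  | XCst a => tree_size (code_letter a) + 20
  | XEps => 20
  | XNe X => wlty X + 12
  end.

Fixpoint wstack S : nat :=
  if S is y :: r then wterm y + wstack r + 2 else 1.

Definition wtask x S X l : nat :=
  wterm x + wstack S + wlty X + tree_size (code_seq (@code_letter C) l).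

Definition good x : Prop := xclosed x /\ xplanar x.

Fixpoint goods S : Prop :=
  if S is y :: r then good y /\ goods r else True.

Lemma tree_size_code_nat i : tree_size (code_nat i) = i.*2.+1.
Proof. by elim: i => //= i ->; lia. Qed.

Lemma size_code_rcons l a : tree_size (code_seq (@code_letter C) (rcons l a)) =
  tree_size (code_seq (@code_letter C) l) + tree_size (code_letter a) + 1.
Proof. by elim: l => [|b l IH] /=; [|rewrite IH]; lia. Qed.

Lemma size_code_lty X : tree_size (code_lty X) <= wlty X.
Proof. by elim: X => [p m|X IHX Y IHY] /=; lia. Qed.

Lemma size_code_xterm x : tree_size (code_xterm x) <= wterm x.
Proof.
elim: x => [i|x IH|x IHx y IHy|a||X] /=; try lia.
by have := size_code_lty X; lia.
Qed.

Lemma wterm_embed t : wterm (embed t) <= 3 * tree_size (code_term t).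
Proof. elim: t => [i|x IH|x IHx y IHy|a|] /=; lia. Qed.

Lemma count_down1 j s :
  count (is_var j) (pmap down1 s) = count (is_var j.+1) s.
Proof. by elim: s => [|[[|i]|X] s IH] //=; rewrite IH. Qed.

Lemma wterm_subst j x y :
  wterm (xsubst j y x) <= wterm x + count (is_var j) (leaves x) * wterm y.
Proof.
elim: x j => [i|x IH|x IHx z IHz|a||X] j /=; try lia.
- by case: eqP => _ /=; lia.
- by have := IH j.+1; rewrite count_down1; lia.
- by rewrite count_cat; have := (IHx j, IHz j) => -[]; lia.
Qed.

(** The bound variable occurs at most once, so [y] is not copied; the 10 of the abstraction and the
    2 of the stack entry are what a beta-step gains. *)
Lemma wterm_beta x y : xplanar (XLam x) ->
  wterm (xsubst 0 y x) <= wterm x + wterm y.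
Proof.
case=> [[s [hs e]] _]; have := wterm_subst 0 x y.
have c0 : count (is_var 0) s = 0.
  by apply/eqP; rewrite -leqn0 leqNgt -has_count.
by case: e => ->; rewrite -?cats1 ?count_cat c0 /=; lia.
Qed.

Lemma good_beta x y : good (XLam x) -> good y -> good (xsubst 0 y x).
Proof.
move=> [cx px] [cy py]; split; first exact: xclosed_beta.
exact: xplanar_beta.
Qed.

Lemma good_ne X : good (XNe X).
Proof. by []. Qed.

Lemma good_app x y : good (XApp x y) <-> good x /\ good y.
Proof.
rewrite /good /xclosed /= all_cat.
by split=> [[/andP[]]|[[-> ?] [-> ?]]] //; tauto.
Qed.

Inductive stack_typed : ty -> seq (xterm C) -> ty -> Prop :=
| stack_nil A : stack_typed A [::] A
| stack_cons A B D y S : xtyped [::] y A -> stack_typed B S D ->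
    stack_typed (A -o B) (y :: S) D.

Lemma stack_nilE A B : stack_typed A [::] B -> A = B.
Proof. by move=> h; inversion h. Qed.

Lemma stack_consE A B y S D : stack_typed (A -o B) (y :: S) D ->
  xtyped [::] y A /\ stack_typed B S D.
Proof. by move=> h; inversion h. Qed.

(** Strong induction on the weight; types serve to choose the rule and to exclude the states without
    one, since a head of base type meets an empty stack. *)
Lemma reads_total x S X l A : good x -> goods S ->
  xtyped [::] x A -> stack_typed A S (lty_ty X) -> exists n E, reads n x S X l E.
Proof.
have [k] := ubnP (wtask x S X l); elim: k => // k IH in x S X l A *.
rewrite ltnS => hk gx gS tx tS.
have eta B D : etable x -> S = [::] -> A = B -o D ->
    exists n E, reads n x S X l E.
  move=> ex eS eA; subst; move: (stack_nilE tS) => eX.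
  case: X eX tS hk => [//|Y Z] [eB eD] _ hk; subst.
  have [|||||n [E h]] := IH x [:: XNe Y] Z l (lty_ty Y -o lty_ty Z) => //.
  (* The 20 in the weight of an arrow pays for the 12 of [XNe] and the 2 of the new stack entry. *)
  - by move: hk; rewrite /wtask /=; lia.
  - by constructor; [apply: xtyped_ne|apply: stack_nil].
  by exists n.+1, E; apply: reads_eta.
case: x hk gx tx eta => [i|x|x y|a||Y] hk gx tx eta; inversion tx; subst.
- by move: H1; rewrite onthE nth_nil.
- case: S hk gS tS eta => [|y S] hk gS tS eta; first exact: (eta A0 B).
  have [[gy gS'] [ty tS']] := (gS, stack_consE tS).
  have [|||||n [E h]] := IH (xsubst 0 y x) S X l B => //.
  - by have := wterm_beta y gx.2; move: hk; rewrite /wtask /=; lia.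
  - exact: good_beta.
  - exact: (@xtyped_subst _ [::]) H1 ty.
  by exists n.+1, E; constructor.
- have [gx' gy] := (good_app x y).1 gx.
  have [|||||n [E h]] := IH x (y :: S) X l (A0 -o A) => //.
  - by move: hk; rewrite /wtask /=; lia.
  - by constructor.
  by exists n.+1, E; constructor.
- case: S hk gS tS eta => [|y [|z S]] hk gS tS eta; first exact: (eta TyO TyO).
    have [[gy _] [ty /stack_nilE eX]] := (gS, stack_consE tS).
    clear tS eta; case: X eX hk => [p m|//] _ hk.
    have [|||||n [E h]] := IH y [::] (LO p m) (rcons l a) TyO => //.
    - by move: hk; rewrite /wtask /= size_code_rcons; lia.
    - by constructor.
    by exists n.+1, E; constructor.
  by have [_ h] := stack_consE tS; inversion h.
- case: S hk gS tS eta => [|y S] hk gS tS eta; last by inversion tS.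
  have := stack_nilE tS; clear hk tS eta; case: X => [p m|//] _.
  by eexists _, _; constructor.
- case: Y hk gx tx tS eta => [p' m'|Y1 Y2] hk gx tx tS eta.
    case: S hk gS tS eta => [|y S] hk gS tS eta; last by inversion tS.
    have := stack_nilE tS; clear hk tS eta; case: X => [p m|//] _.
    by eexists _, _; constructor.
  case: S hk gS tS eta => [|y S] hk gS tS eta.
    exact: (eta (lty_ty Y1) (lty_ty Y2)).
  have [[gy gS'] [ty tS']] := (gS, stack_consE tS).
  have [|||||n [E h]] := IH y [::] Y1 [::] (lty_ty Y1) => //.
  - by move: hk; rewrite /wtask /=; lia.
  - by constructor.
  have [|||||n' [E' h']] := IH (XNe Y2) S X l (lty_ty Y2) => //.
  - by move: hk; rewrite /wtask /=; lia.
  - by constructor.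
  by eexists _, _; constructor; eauto.
Qed.

Definition code_edge (e : ledge C) : tree :=
  Node (code_vert e.1)
    (Node (code_vert e.2.1) (code_seq (@code_letter C) e.2.2)).

Definition code_edges (E : seq (ledge C)) : tree := code_seq code_edge E.

Lemma size_code_cat (E E' : seq (ledge C)) :
  (tree_size (code_edges (E ++ E'))).+1 =
  tree_size (code_edges E) + tree_size (code_edges E').
Proof. by elim: E => //= e E IH; lia. Qed.

(** At [reads_ne] the weight of the task exceeds the sum of the weights of both subtasks, so that
    quantities that add up stay below it. *)
Lemma reads_bound n x S X l E : reads n x S X l E -> good x -> goods S ->
  n <= wtask x S X l /\ tree_size (code_edges E) <= wtask x S X l.
Proof.
elim=> {n x S X l E}.
- move=> n x y S X l E _ IH /good_app[gx gy] gS.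
  by have [] := IH gx (conj gy gS); rewrite /wtask /=; lia.
- move=> n x X Y l E _ _ IH gx gS.
  by have [] := IH gx (conj (good_ne X) gS); rewrite /wtask /=; lia.
- move=> n x y S X l E _ IH gx [gy gS].
  have [] := IH (good_beta gx gy) gS; have := wterm_beta y gx.2.
  by rewrite /wtask /=; lia.
- move=> n a y p m l E _ IH _ [gy _].
  by have [] := IH gy I; rewrite /wtask /= size_code_rcons; lia.
- by move=> p m l _ _; rewrite /wtask /=; lia.
- move=> n n' y Y1 Y2 S X l E E' _ IH1 _ IH2 _ [gy gS].
  have [] := IH1 gy I; have [] := IH2 (good_ne Y2) gS.
  by have := size_code_cat E E'; rewrite /wtask /=; lia.
- by move=> p' m' p m l _ _; rewrite /wtask /=; lia.
Qed.

End Weights.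

(** * Non-crossing matchings *)

Section Noncrossing.
Variable V : eqType.
Implicit Types (L : seq V) (E : seq (V * V)).

(* The vertices of [L] are on a circle; an innermost arc joins neighbours. *)
Inductive nc : seq V -> seq (V * V) -> Prop :=
| nc_nil : nc [::] [::]
| nc_skip L1 L2 x E : nc (L1 ++ L2) E -> nc (L1 ++ x :: L2) E
| nc_arc L1 L2 x y E : nc (L1 ++ L2) E -> nc (L1 ++ x :: y :: L2) ((x, y) :: E)
| nc_arc_rev L1 L2 x y E :
    nc (L1 ++ L2) E -> nc (L1 ++ x :: y :: L2) ((y, x) :: E)
| nc_perm L E E' : perm_eq E E' -> nc L E -> nc L E'.

Lemma nc_skips L1 L L2 E : nc (L1 ++ L2) E -> nc (L1 ++ L ++ L2) E.
Proof. by elim: L => //= x L IH /IH; apply: nc_skip. Qed.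

(** A whole matching fits in any gap of another one: its derivation is replayed between [L1] and
    [L2]. *)
Lemma nc_insert L1 L2 M E E' :
  nc M E' -> nc (L1 ++ L2) E -> nc (L1 ++ M ++ L2) (E' ++ E).
Proof.
move=> h; elim: h L1 L2 => {M E'} //=.
- move=> M1 M2 x E' _ IH L1 L2 h; rewrite -catA /= catA; apply: nc_skip.
  by have := IH L1 L2 h; rewrite -!catA.
- move=> M1 M2 x y E' _ IH L1 L2 h; rewrite -catA /= catA; apply: nc_arc.
  by have := IH L1 L2 h; rewrite -!catA.
- move=> M1 M2 x y E' _ IH L1 L2 h; rewrite -catA /= catA; apply: nc_arc_rev.
  by have := IH L1 L2 h; rewrite -!catA.
- move=> M E1 E2 hp _ IH L1 L2 h; apply: nc_perm (IH _ _ h).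
  by rewrite perm_cat2r.
Qed.

Lemma nc_pair x y : nc [:: x; y] [:: (x, y)].
Proof. exact: (@nc_arc [::] [::] x y _ nc_nil). Qed.

Lemma nc_pair_rev x y : nc [:: x; y] [:: (y, x)].
Proof. exact: (@nc_arc_rev [::] [::] x y _ nc_nil). Qed.

Lemma nc_around x y a b L E : nc [:: x; y] [:: (a, b)] ->
  nc L E -> nc (x :: L ++ [:: y]) ((a, b) :: E).
Proof.
move=> hp hL; apply: nc_perm (@nc_insert [:: x] [:: y] L _ E hL hp).
by rewrite cats1 perm_rcons.
Qed.

(** The circle may be cut anywhere. The delicate case is an arc that starts at the vertex moved: it
    becomes an arc around all the rest. *)
Lemma nc_rot1 x L E : nc (x :: L) E -> nc (rcons L x) E.
Proof.
move: {-2}(x :: L) (erefl (x :: L)) => L0 e h.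
elim: h x L e => {L0 E} //=.
- move=> [|w L1] L2 z E h IH x L [<- <-] /=.
    by rewrite -cats1; apply: nc_skip; rewrite cats0.
  rewrite rcons_cat /=; apply: nc_skip; rewrite -rcons_cat; exact: (IH w).
- move=> [|w L1] L2 z z' E h IH x L [<- <-] /=.
    by rewrite -cats1; apply: nc_around => //; apply: nc_pair_rev.
  rewrite rcons_cat /=; apply: nc_arc; rewrite -rcons_cat; exact: (IH w).
- move=> [|w L1] L2 z z' E h IH x L [<- <-] /=.
    by rewrite -cats1; apply: nc_around => //; apply: nc_pair.
  rewrite rcons_cat /=; apply: nc_arc_rev; rewrite -rcons_cat; exact: (IH w).
- move=> L0 E E' hp h IH x L e; apply: nc_perm hp _; exact: IH.
Qed.

Lemma nc_rot L1 L2 E : nc (L1 ++ L2) E -> nc (L2 ++ L1) E.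
Proof.
elim: L1 L2 => [|x L1 IH] L2; first by rewrite cats0.
by move=> /nc_rot1; rewrite rcons_cat => /IH; rewrite cat_rcons.
Qed.

Definition ends E : seq V := unzip1 E ++ unzip2 E.

Lemma perm_ends_cons x y E : perm_eq (ends ((x, y) :: E)) (x :: y :: ends E).
Proof. by rewrite /ends /= perm_cons perm_catC /= perm_cons perm_catC. Qed.

Lemma perm_ends E E' : perm_eq E E' -> perm_eq (ends E) (ends E').
Proof. by move=> h; apply: perm_cat; apply: perm_map. Qed.

Lemma nc_ends L E : nc L E -> uniq L -> uniq (ends E) /\ {subset ends E <= L}.
Proof.
have arc L1 L2 x y F : uniq (L1 ++ x :: y :: L2) ->
    (uniq (L1 ++ L2) -> uniq (ends F) /\ {subset ends F <= L1 ++ L2}) ->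
    uniq (x :: y :: ends F) /\
    {subset x :: y :: ends F <= L1 ++ x :: y :: L2}.
  rewrite (perm_uniq (permEl (perm_catCA L1 [:: x; y] L2))) /= => /and3P[hx hy hu] IH.
  have [ue se] := IH hu; split.
    rewrite ue andbT; apply/andP; split; last exact: contra (@se y) hy.
    by move: hx; rewrite !inE !negb_or => /andP[-> hx]; apply: contra (@se x) hx.
  move=> z hz; rewrite (perm_mem (permEl (perm_catCA L1 [:: x; y] L2))).
  by move: hz; rewrite !inE => /or3P[->|->|/se ->]; rewrite ?orbT.
move=> h; elim: h => {L E} //.
- move=> L1 L2 x E _ IH.
  rewrite (perm_uniq (permEl (perm_catCA L1 [:: x] L2))) /= => /andP[_ /IH[-> h]].
  split=> // z /h; rewrite (perm_mem (permEl (perm_catCA L1 [:: x] L2))) inE => ->.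
  by rewrite orbT.
- move=> L1 L2 x y E _ IH hu; have [u1 u2] := arc _ _ _ _ _ hu IH.
  rewrite (perm_uniq (perm_ends_cons x y E)); split=> // z.
  by rewrite (perm_mem (perm_ends_cons x y E)); apply: u2.
- move=> L1 L2 x y E _ IH hu; have [u1 u2] := arc _ _ _ _ _ hu IH.
  have hp : perm_eq (ends ((y, x) :: E)) (x :: y :: ends E).
    by rewrite (permPl (perm_ends_cons y x E)) (permEl (perm_catCA [:: y] [:: x] _)).
  by rewrite (perm_uniq hp); split=> // z; rewrite (perm_mem hp); apply: u2.
- move=> L E E' /perm_ends hp _ IH /IH[].
  rewrite (perm_uniq hp) => -> h; split=> // z; rewrite -(perm_mem hp).
  exact: h.
Qed.

Lemma nc_mem L E p q : nc L E -> (p, q) \in E -> p \in L /\ q \in L.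
Proof.
move=> h; elim: h => {L E} //=.
- move=> L1 L2 x E _ IH /IH; rewrite !mem_cat !inE => -[].
  by do 2 case/orP=> ->; rewrite ?orbT.
- move=> L1 L2 x y E _ IH; rewrite inE => /orP[/eqP[-> ->]|/IH].
    by rewrite !mem_cat !inE !eqxx !orbT.
  by rewrite !mem_cat !inE => -[]; do 2 case/orP=> ->; rewrite ?orbT.
- move=> L1 L2 x y E _ IH; rewrite inE => /orP[/eqP[-> ->]|/IH].
    by rewrite !mem_cat !inE !eqxx !orbT.
  by rewrite !mem_cat !inE => -[]; do 2 case/orP=> ->; rewrite ?orbT.
- by move=> L E E' hp _ IH; rewrite -(perm_mem hp).
Qed.

(** The ends of an innermost arc are neighbours, so no other vertex lies between them, and
    conversely both are on the same side of any other arc. *)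
Lemma nc_planar (pos : V -> nat) L E : nc L E -> sorted ltn (map pos L) ->
  forall p q p' q', (p, q) \in E -> (p', q') \in E ->
  between (pos p) (pos q) (pos p') = between (pos p) (pos q) (pos q').
Proof.
have gap L1 L2 x y z : sorted ltn (map pos (L1 ++ x :: y :: L2)) ->
    z \in L1 ++ L2 -> pos x < pos y /\ (pos z < pos x \/ pos y < pos z).
  rewrite map_cat /= (sorted_pairwise ltn_trans) pairwise_cat /=.
  case/and3P=> /allrelP h1 _ /and3P[/andP[hxy _] /allP h2 _] hz; split=> //; move: hz.
  rewrite mem_cat => /orP[hz|hz].
    by left; apply: h1; rewrite ?map_f ?inE ?eqxx.
  by right; apply: h2; apply: map_f.
have sub L1 L2 (s : seq V) : sorted ltn (map pos (L1 ++ s ++ L2)) ->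
    sorted ltn (map pos (L1 ++ L2)).
  apply: (subseq_sorted ltn_trans); apply: map_subseq.
  exact: cat_subseq (subseq_refl _) (suffix_subseq _ _).
have arc L1 L2 x y F a b : sorted ltn (map pos (L1 ++ x :: y :: L2)) ->
    nc (L1 ++ L2) F -> (a, b) = (x, y) \/ (a, b) = (y, x) ->
    (forall p q p' q', (p, q) \in F -> (p', q') \in F ->
     between (pos p) (pos q) (pos p') = between (pos p) (pos q) (pos q')) ->
    forall p q p' q', (p, q) \in (a, b) :: F -> (p', q') \in (a, b) :: F ->
    between (pos p) (pos q) (pos p') = between (pos p) (pos q) (pos q').
  move=> hs hn hab IH p q p' q'; rewrite !inE.
  case/orP=> [/eqP[-> ->]|hp]; case/orP=> [/eqP[-> ->]|hp'].
  - by rewrite /between; lia.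
  - have [/(gap _ _ _ _ _ hs) h1 /(gap _ _ _ _ _ hs) h2] := nc_mem hn hp'.
    by case: hab => -[-> ->]; rewrite /between; lia.
  - have [/(gap _ _ _ _ _ hs) h1 /(gap _ _ _ _ _ hs) h2] := nc_mem hn hp.
    by case: hab => -[-> ->]; rewrite /between; lia.
  - exact: IH.
move=> h; elim: h => {L E} //=.
- by move=> L1 L2 x E _ IH /(sub _ _ [:: x]) /IH.
- move=> L1 L2 x y E hn IH hs; apply: (arc _ _ _ _ _ _ _ hs hn); first by left.
  exact/IH/(sub _ _ [:: x; y]).
- move=> L1 L2 x y E hn IH hs; apply: (arc _ _ _ _ _ _ _ hs hn); first by right.
  exact/IH/(sub _ _ [:: x; y]).
- move=> L E E' hp _ IH hs p q p' q'; rewrite -!(perm_mem hp); exact: IH.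
Qed.

End Noncrossing.

(** * From readings to diagrams *)

Fixpoint lword (V : Type) (X : lty V) : seq V :=
  match X with
  | LO p m => [:: p; m]
  | LArr X Y => lword Y ++ rev (lword X)
  end.

(** The words of types alternate [+-], so parity gives the sign: the sources are the even letters of
    the domain and the odd ones of the codomain. *)
Definition source (v : vert) : bool := v.1 (+) ~~ odd v.2.

(** [b] is the polarity: [true] for the place of a result, where paths enter at [m] and leave at
    [p], and [false] for that of a variable. *)
Fixpoint oriented (b : bool) (X : lty vert) : bool :=
  match X with
  | LO p m => (source p == ~~ b) && (source m == b)
  | LArr X Y => oriented (~~ b) X && oriented b Y
  end.

Section Reading.
Variable C : finType.
Implicit Types (x y : xterm C) (S : seq (xterm C)) (l : seq C).

Definition oriented_leaf (z : leaf) : bool :=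
  if z is inr X then oriented false X else true.

Lemma oriented_subst j x y : all oriented_leaf (leaves x) ->
  all oriented_leaf (leaves y) -> all oriented_leaf (leaves (xsubst j y x)).
Proof.
have down s : all oriented_leaf (pmap down1 s) = all oriented_leaf s.
  by elim: s => [|[[|i]|X] s IH] //=; rewrite IH.
move=> hx hy; elim: x j hx => [i|x IH|x IHx z IHz|a||X] j //=.
- by case: eqP.
- by rewrite !down; apply: IH.
- by rewrite !all_cat => /andP[/IHx-> /IHz->].
Qed.

Lemma reads_oriented n x S X l E : reads n x S X l E ->
  all oriented_leaf (leaves x) ->
  all (fun y => all oriented_leaf (leaves y)) S -> oriented true X ->
  forall e, e \in E -> source e.1 && ~~ source e.2.1.
Proof.
elim=> {n x S X l E} /=.
- move=> n x y S X l E _ IH; rewrite all_cat => /andP[hx hy] hS hX.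
  by apply: IH => //; apply/andP.
- move=> n x X Y l E _ _ IH hx _ /andP[hX hY]; apply: IH => //.
  by rewrite /= hX.
- move=> n x y S X l E _ IH hx /andP[hy hS] hX; apply: IH => //.
  apply: oriented_subst => //.
  by elim: (leaves x) hx => [|[[|i]|Z] s IHs] //=; [move=> /andP[-> /IHs]].
- by move=> n a y p m l E _ IH _ /andP[hy _] hX; apply: IH.
- by move=> p m l _ _ /andP[/eqP hp /eqP hm] e; rewrite inE => /eqP-> /=; rewrite hp hm.
- move=> n n' y Y1 Y2 S X l E E' _ IH1 _ IH2; rewrite andbT.
  move=> /andP[h1 h2] /andP[hy hS] hX e; rewrite mem_cat => /orP[].
    by apply: IH1.
  by apply: IH2 => //; rewrite h2.
- move=> p' m' p m l; rewrite andbT => /andP[/eqP hp' /eqP hm'] _.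
  move=> /andP[/eqP hp /eqP hm] e.
  by rewrite !inE => /orP[]/eqP-> /=; rewrite ?hp ?hm ?hp' ?hm'.
Qed.

Definition bleaves (s : seq leaf) : seq vert :=
  flatten [seq if z is inr X then lword X else [::] | z <- s].

Lemma bleaves_cat s s' : bleaves (s ++ s') = bleaves s ++ bleaves s'.
Proof. by rewrite /bleaves map_cat flatten_cat. Qed.

Definition bstack S : seq vert := flatten [seq bleaves (leaves y) | y <- S].

Definition arcs (E : seq (ledge C)) : seq (vert * vert) :=
  [seq (e.1, e.2.1) | e <- E].

(* The boundary of a task: the occurrences of located variables, from left to
   right, then the result type, from right to left. *)
Lemma reads_nc n x S X l E : reads n x S X l E -> good x -> goods S ->
  nc (bleaves (leaves x) ++ bstack S ++ rev (lword X)) (arcs E).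
Proof.
elim=> {n x S X l E}.
- move=> n x y S X l E _ IH /good_app[gx gy] gS.
  by have := IH gx (conj gy gS); rewrite /= bleaves_cat /bstack /= -!catA.
- move=> n x X Y l E _ _ IH gx _.
  have := IH gx (conj (good_ne C X) I).
  by rewrite /bstack /bleaves /= !cats0 rev_cat revK.
- move=> n x y S X l E _ IH gx [gy gS].
  have := IH (good_beta gx gy) gS.
  case: (leaves_beta gx.1 gx.2 gy.1) => -> h.
    by move: h; rewrite bleaves_cat /bstack /= -!catA.
  (* The variable does not occur: the argument is erased and the vertices of its leaves stay
     isolated. *)
  by rewrite /bstack /= -catA; apply: nc_skips.
- move=> n a y p m l E _ IH _ [gy _].
  by have := IH gy I; rewrite /bstack /= cats0.
- by move=> p m l _ _; apply: nc_pair.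
- move=> n n' y Y1 Y2 S X l E E' _ IH1 _ IH2 _ [gy gS].
  (* Rotated so that its result comes first, the matching of the argument is inserted just after the
     word of [Y2]; this forms the word [lword Y2 ++ rev (lword Y1)] of the arrow. *)
  have := nc_rot (IH1 gy I); rewrite /= => h1.
  have := IH2 (good_ne C Y2) gS; rewrite {1}/bleaves /= cats0 => h2.
  have := nc_insert h1 h2; rewrite /arcs map_cat /bstack /bleaves /=.
  by rewrite cats0 -!catA.
- move=> p' m' p m l _ _ /=.
  apply: nc_perm (@nc_around _ p' p p' p [:: m'; m] _ (nc_pair _ _) (nc_pair_rev _ _)).
  by rewrite (permEl (perm_catC [:: _] [:: _])).
Qed.

Fixpoint lookup (v : vert) (E : seq (ledge C)) : option (vert * seq C) :=
  if E is e :: E then if e.1 == v then Some e.2 else lookup v E else None.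

Lemma lookup_mem v E r : lookup v E = Some r -> (v, r) \in E.
Proof.
elim: E => //= -[v' r'] E IH /=; rewrite inE; case: eqP => [<- [<-]|_ /IH->].
  by rewrite eqxx.
by rewrite orbT.
Qed.

Lemma mem_lookup v E r :
  uniq (unzip1 E) -> (v, r) \in E -> lookup v E = Some r.
Proof.
elim: E => //= -[v' r'] E IH /= /andP[hv hu]; rewrite inE.
case/orP=> [/eqP[-> ->]|h]; first by rewrite eqxx.
case: eqP => [e|_]; last exact: IH.
by case/negP: hv; rewrite e; apply/mapP; exists (v, r).
Qed.

Section Diagram.
Variables (u v : seq sign).

Definition vert_of (p : vertex u v) : vert :=
  match p with inl i => (false, val i) | inr j => (true, val j) end.

Definition of_vert (p : vert) : option (vertex u v) :=
  if p.1 then omap inr (insub p.2) else omap inl (insub p.2).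

Lemma vert_ofK : pcancel vert_of of_vert.
Proof. by case=> i; rewrite /of_vert /= valK. Qed.

Lemma of_vertK p q : of_vert p = Some q -> vert_of q = p.
Proof.
case: p => [[] i]; rewrite /of_vert /=; case: insubP => //= k _ e [<-] /=;
by rewrite e.
Qed.

Definition edges_diag (E : seq (ledge C)) : diag C u v :=
  [ffun p => if lookup (vert_of p) E is Some (q, l)
             then omap (fun q => (q, l)) (of_vert q) else None].

Definition boundary : seq vert :=
  [seq (false, i) | i <- iota 0 (size u)] ++
  rev [seq (true, j) | j <- iota 0 (size v)].

Definition vert_pos (p : vert) : nat :=
  if p.1 then size u + (size v - p.2.+1) else p.2.

Lemma boundary_sorted : sorted ltn (map vert_pos boundary).
Proof.
have -> : map vert_pos boundary = iota 0 (size u + size v); last exact: iota_ltn_sorted.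
rewrite map_cat -map_comp /= map_rev -map_comp iotaD; congr (_ ++ _).
  by rewrite -[RHS]map_id.
apply: (@eq_from_nth _ 0); rewrite size_rev !size_map !size_iota // => i hi.
rewrite nth_rev ?size_map ?size_iota // (nth_map 0) ?size_iota; last by lia.
by rewrite /vert_pos /= !nth_iota; lia.
Qed.

Lemma boundary_uniq : uniq boundary.
Proof.
apply: (map_uniq (f := vert_pos)); apply: sorted_uniq boundary_sorted.
  exact: ltn_trans.
by move=> i; rewrite /= ltnn.
Qed.

Lemma boundary_of_vert p : p \in boundary -> exists q, vert_of q = p.
Proof.
rewrite mem_cat mem_rev => /orP[]/mapP[i hi ->]; move: hi; rewrite mem_iota add0n => hi.
  by exists (inl (Ordinal hi)).
by exists (inr (Ordinal hi)).
Qed.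

Lemma edges_diagP E p q l : edges_diag E p = Some (q, l) ->
  (vert_of p, (vert_of q, l)) \in E.
Proof.
rewrite ffunE; case e: (lookup _ _) => [[q' l']|] //=.
case e': (of_vert q') => [q''|] //= [<- <-]; rewrite (of_vertK e').
exact: lookup_mem.
Qed.

(** [nc] is used twice: the ends of the edge are on the boundary, and the sources are distinct, so
    that [lookup] finds this very edge. *)
Lemma edges_diag_mem E p q l : nc boundary (arcs E) ->
  (p, (q, l)) \in E -> exists p' q', [/\ vert_of p' = p, vert_of q' = q &
    edges_diag E p' = Some (q', l)].
Proof.
move=> hn hE.
have /(nc_mem hn)[/boundary_of_vert[p' ep] /boundary_of_vert[q' eq]] :
    (p, q) \in arcs E by apply/mapP; exists (p, (q, l)).
exists p', q'; split=> //; rewrite ffunE ep (mem_lookup _ hE) -?eq ?vert_ofK //.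
have [] := nc_ends hn boundary_uniq; rewrite /ends cat_uniq => /and3P[h _ _] _.
by move: h; rewrite /arcs /unzip1 -map_comp.
Qed.

End Diagram.

Definition alt (n : nat) : seq sign := flatten (nseq n [:: Plus; Minus]).

Lemma size_alt n : size (alt n) = n.*2.
Proof. by elim: n => //= n ->. Qed.

Lemma nth_alt n i : i < n.*2 -> is_plus (nth Plus (alt n) i) = ~~ odd i.
Proof. by elim: n i => [|n IH] [|[|i]] //= hi; rewrite IH // negbK. Qed.

Lemma source_vert_of m n (p : vertex (alt m) (alt n)) :
  is_source p = source (vert_of p).
Proof.
by case: p => -[i hi] /=; move: (hi); rewrite size_alt => hi'; rewrite nth_alt.
Qed.

Lemma edges_transdiag m n E : nc (boundary (alt m) (alt n)) (arcs E) ->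
  (forall e, e \in E -> source e.1 && ~~ source e.2.1) ->
  exists D : transdiag C (alt m) (alt n),
    td_diag D = edges_diag (alt m) (alt n) E.
Proof.
move=> hn ho.
have arcP p q : edge (edges_diag (alt m) (alt n) E) p q ->
    (vert_of p, vert_of q) \in arcs E.
  by case=> l /edges_diagP h; apply/mapP; eexists; first exact: h.
have h1 : well_oriented (edges_diag (alt m) (alt n) E).
  move=> p q [l /edges_diagP /ho /= /andP[]].
  by rewrite !source_vert_of.
have h2 : edge_injective (edges_diag (alt m) (alt n) E).
  move=> p p' q /arcP h /arcP h'; apply: (pcan_inj (@vert_ofK _ _)).
  have [] := nc_ends hn (boundary_uniq _ _); rewrite /ends cat_uniq => /and3P[_ _ hu] _.
  move: h h' hu; elim: (arcs E) => //= -[a b] A IH; rewrite !inE.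
  case/orP=> [/eqP[-> ->]|h]; case/orP=> [/eqP[-> e]|h'] //= /andP[hb hu].
  - by case/negP: hb; apply/mapP; exists (vert_of p', b).
  - by case/negP: hb; rewrite -e; apply/mapP; exists (vert_of p, vert_of q).
  - exact: IH.
have h3 : planar (edges_diag (alt m) (alt n) E).
  have posE (p : vertex (alt m) (alt n)) :
      position p = vert_pos (alt m) (alt n) (vert_of p) by case: p.
  move=> p q p' q' /arcP h /arcP h'; rewrite !posE.
  exact: (nc_planar hn (boundary_sorted _ _)).
by exists (TransDiag h1 h2 h3).
Qed.

End Reading.

(** * Composition of diagrams *)

Section Composition.
Variable C : finType.

Section Follow.
Variables (u v w : seq sign) (f : diag C u v) (g : diag C v w).

(** One round of [follow]: the path stays in the middle word ([inl]) or leaves it ([inr]). *)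
Definition hop (k : 'I_(size v)) :
    option (('I_(size v) + vertex u w) * seq C) :=
  if is_plus (nth Plus v k) then
    match g (inl k) with
    | Some (inl k', l) => Some (inl k', l)
    | Some (inr j, l) => Some (inr (inr j), l)
    | None => None
    end
  else
    match f (inr k) with
    | Some (inr k', l) => Some (inl k', l)
    | Some (inl i, l) => Some (inr (inl i), l)
    | None => None
    end.

Lemma followS n k l : follow f g n.+1 k l =
  match hop k with
  | Some (inl k', l') => follow f g n k' (l ++ l')
  | Some (inr o, l') => Some (o, l ++ l')
  | None => None
  end.
Proof.
rewrite /= /hop; case: ifP => _; first by case: (g _) => [[[]]|].
by case: (f _) => [[[]]|].
Qed.

Lemma follow_cat n k l l' : follow f g n k (l ++ l') =
  omap (fun r => (r.1, l ++ r.2)) (follow f g n k l').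
Proof.
elim: n k l' => // n IH k l'; rewrite !followS.
by case: (hop k) => [[[k'|o] m]|] //=; rewrite -catA ?IH.
Qed.

Lemma followW n n' k l r : n <= n' ->
  follow f g n k l = Some r -> follow f g n' k l = Some r.
Proof.
elim: n n' k l => // n IH [//|n'] k l le_n; rewrite !followS.
by case: (hop k) => [[[k'|o] m]|] //; apply: IH.
Qed.

(* Once a round adds no vertex from which a path leaves the middle word, no
   later round does. *)
Lemma follow_fuel n k l r :
  follow f g n k l = Some r -> follow f g (size v) k l = Some r.
Proof.
(* The [m]-th iterate from [set0] consists of the letters from which the path leaves within [m]
   rounds; the chain is stable after [size v] of them. *)
pose F (X : {set 'I_(size v)}) := [set k |
  match hop k with
  | Some (inl k', _) => k' \in X
  | Some (inr _, _) => true
  | None => false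
  end].
have monoF : {homo F : X Y / X \subset Y}.
  move=> X Y /subsetP sXY; apply/subsetP => i; rewrite !inE.
  by case: (hop i) => [[[k'|o] m]|] //; apply: sXY.
have followF m i l' : (follow f g m i l' != None) = (i \in iter m F set0).
  elim: m i l' => [|m IH] i l'; first by rewrite inE.
  by rewrite followS /= inE; case: (hop i) => [[[k'|o] l'']|].
move=> h; have : follow f g (size v) k l != None.
  have hk : k \in iter n F set0 by rewrite -(followF _ _ l) h.
  have := subsetP (iter_sub_fix monoF n) _ hk.
  by rewrite /fixset card_ord -(followF _ _ l).
case e: (follow f g (size v) k l) => [r'|//] _.
case/orP: (leq_total n (size v)) => le_n; first by rewrite -e (followW le_n h).
by rewrite -h (followW le_n e).
Qed.

End Follow.

Definition ends_at (W : Type) u v (ed ec : nat -> W) (p : vertex u v) : W :=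
  match p with inl i => ed i | inr j => ec j end.

Definition embeds (W : Type) u v (D : diag C u v)
    (R : W -> seq C -> W -> Prop) (ed ec : nat -> W) : Prop :=
  forall p q l, D p = Some (q, l) -> R (ends_at ed ec p) l (ends_at ed ec q).

(** A property of a row of vertices, indexed by the letters of a word, in an arbitrary graph. *)
Definition wire_prop : Type :=
  forall W : Type, (W -> seq C -> W -> Prop) -> (nat -> W) -> Prop.

(* [A] depends on the reachability between the vertices of its wire only. *)
Definition local (A : wire_prop) : Prop :=
  forall (W W' : Type) (h : W -> W') R R' (e : nat -> W),
    (forall x l y, R x l y <-> R' (h x) l (h y)) ->
    A W R e <-> A W' R' (fun i => h (e i)).

(** A kind of Hoare triple, valid in every graph around [D]: the surroundings may also join letters
    of the same side. *)
Definition transforms u v (D : diag C u v) (A B : wire_prop) : Prop :=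
  forall (W : Type) R (ed ec : nat -> W), labelled_preorder R ->
    embeds D R ed ec -> A W R ed -> B W R ec.

Section Comp.
Variables (u v w : seq sign) (f : diag C u v) (g : diag C v w).
Variables (W : Type) (R : W -> seq C -> W -> Prop) (ed ec : nat -> W).
Hypothesis preR : labelled_preorder R.
Hypothesis embR : embeds (diag_comp f g) R ed ec.

(** The middle letters are the vertices [inr k]. An edge of [f] or [g] between two outer vertices is
    an edge of the composite, hence already in [R] by [embR]. *)
Inductive mstep : W + nat -> seq C -> W + nat -> Prop :=
| mstep_old x l y : R x l y -> mstep (inl x) l (inl y)
| mstep_in i (k : 'I_(size v)) l :
    f (inl i) = Some (inr k, l) -> mstep (inl (ed i)) l (inr (val k))
| mstep_in' j (k : 'I_(size v)) l :
    g (inr j) = Some (inl k, l) -> mstep (inl (ec j)) l (inr (val k))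
| mstep_hop (k k' : 'I_(size v)) l :
    hop f g k = Some (inl k', l) -> mstep (inr (val k)) l (inr (val k'))
| mstep_out (k : 'I_(size v)) o l : hop f g k = Some (inr o, l) ->
    mstep (inr (val k)) l (inl (ends_at ed ec o)).

Inductive mreach : W + nat -> seq C -> W + nat -> Prop :=
| mreach_nil x : mreach x [::] x
| mreach_cons x l y l' z :
    mstep x l y -> mreach y l' z -> mreach x (l ++ l') z.

Lemma mreach_pre : labelled_preorder mreach.
Proof.
split; first exact: mreach_nil.
move=> p l q l' r h; elim: h l' r => // x l1 y l2 z hs _ IH l' r h'.
by rewrite -catA; apply: mreach_cons hs _; apply: IH.
Qed.

Lemma mreach1 x l y : mstep x l y -> mreach x l y.
Proof. by rewrite -{2}[l]cats0 => h; apply: mreach_cons h (mreach_nil _). Qed.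

(** The invariant behind conservativity: a path from a middle letter first leaves the middle word
    along [follow], then continues in [R]. Preceded by the edge that entered the middle word, its
    first part is an edge of the composite. *)
Lemma mreach_to a l y : mreach a l (inl y) ->
  match a with
  | inl x => R x l y
  | inr i => exists n (k : 'I_(size v)) o l1 l2, [/\ val k = i,
      follow f g n k [::] = Some (o, l1), R (ends_at ed ec o) l2 y &
      l = l1 ++ l2]
  end.
Proof.
move: {-2}(inl y) (erefl (inl y : W + nat)) => b e h; elim: h e => {a l b}.
  by move=> a ->; apply: lp_refl.
move=> a l1 b l2 c hs _ IH /IH {IH}; case: a l1 b / hs.
- by move=> x l z hR hR'; apply: lp_trans hR hR'.
- move=> i k l hf [n [k' [o [l1 [l3 [/val_inj -> hn hR ->]]]]]].
  rewrite catA; apply: lp_trans hR => //.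
  have /= := @embR (inl i) o (l ++ l1); apply.
  rewrite ffunE hf -[l in follow _ _ _ _ l]cats0.
  by rewrite follow_cat (follow_fuel hn).
- move=> j k l hg [n [k' [o [l1 [l3 [/val_inj -> hn hR ->]]]]]].
  rewrite catA; apply: lp_trans hR => //.
  have /= := @embR (inr j) o (l ++ l1); apply.
  rewrite ffunE hg -[l in follow _ _ _ _ l]cats0.
  by rewrite follow_cat (follow_fuel hn).
- move=> k k' l hh [n [k'' [o [l1 [l3 [/val_inj e hn hR ->]]]]]]; subst k''.
  exists n.+1, k, o, (l ++ l1), l3; split=> //; last by rewrite catA.
  by rewrite followS hh /= -[l]cats0 follow_cat hn cats0.
- move=> k o l hh hR; exists 1, k, o, l, l2; split=> //.
  by rewrite followS hh.
Qed.

Lemma mreach_old x l y : R x l y <-> mreach (inl x) l (inl y).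
Proof.
by split=> [h|/mreach_to //]; apply: mreach1; constructor.
Qed.

End Comp.

Lemma well_oriented_comp u v w (f : diag C u v) (g : diag C v w) :
  well_oriented f -> well_oriented g -> well_oriented (diag_comp f g).
Proof.
move=> of_ og.
have ofl n k l o l' : follow f g n k l = Some (o, l') -> ~~ is_source o.
  elim: n k l => // n IH k l; rewrite followS /hop.
  case: ifP => _.
    case e: (g _) => [[[k'|j] m]|] //; first exact: IH.
    by case=> <- _; have [] := og _ _ (ex_intro _ _ e).
  case e: (f _) => [[[i|k'] m]|] //; last exact: IH.
  by case=> <- _; have [] := of_ _ _ (ex_intro _ _ e).
move=> p q [l]; rewrite ffunE; case: p => [i|j].
  case e: (f _) => [[[i'|k] m]|] //; have [h1 h2] := of_ _ _ (ex_intro _ _ e).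
    by case=> <- _.
  by move/ofl.
case e: (g _) => [[[k|j'] m]|] //; have [h1 h2] := og _ _ (ex_intro _ _ e).
  by move/ofl.
by case=> <- _.
Qed.

(** Both factors are used in the extended graph; locality carries [A] into it and [D] out of it.
    Orientation tells for which factor a middle letter is a source, hence that its edge is a
    [hop]. *)
Lemma transforms_comp u v w (f : diag C u v) (g : diag C v w) A B D :
  well_oriented f -> well_oriented g -> local A -> local D ->
  transforms f A B -> transforms g B D ->
  transforms (diag_comp f g) A D.
Proof.
move=> of_ og lA lD tf tg W R ed ec preR embR hA.
pose R' := mreach f g R ed ec.
have old := mreach_old preR embR.
apply/(lD _ _ inl R R' _ (old)).
apply: (tg _ R' (inr : nat -> W + nat)); first exact: mreach_pre.
  move=> p q l h.
  have [] := og _ _ (ex_intro _ _ h).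
  case: p q h => [k|j] [k'|j'] h /= sp sq.
  - by apply/mreach1/mstep_hop; rewrite /hop sp h.
  - apply/mreach1/(@mstep_out _ _ _ _ _ _ R ed ec k (inr j')).
    by rewrite /hop sp h.
  - exact/mreach1/mstep_in'.
  - apply/old; have /= := @embR (inr j) (inr j') l; apply.
    by rewrite ffunE h.
apply: (tf _ R' (fun i => inl (ed i))); first exact: mreach_pre.
  move=> p q l h.
  have [] := of_ _ _ (ex_intro _ _ h).
  case: p q h => [k|j] [k'|j'] h /= sp sq.
  - apply/old; have /= := @embR (inl k) (inl k') l; apply.
    by rewrite ffunE h.
  - exact/mreach1/mstep_in.
  - apply/mreach1/(@mstep_out _ _ _ _ _ _ R ed ec j (inl k')).
    by rewrite /hop (negPf sp) h.
  - by apply/mreach1/mstep_hop; rewrite /hop (negPf sp) h.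
exact/(lA _ _ inl R R' _ old).
Qed.

End Composition.

(** * Wires of a type *)

Fixpoint natoms (A : ty) : nat :=
  if A is A -o B then natoms A + natoms B else 1.

(* Numbers the letters of the word of [A] from [n] on, or those of its reversal
   if [b]; the second component is the next free number. *)
Fixpoint lab (b : bool) (A : ty) (n : nat) : lty nat * nat :=
  match A with
  | TyO => (if b then LO n.+1 n else LO n n.+1, n.+2)
  | A -o B =>
    if b then
      let r := lab false A n in let r' := lab true B r.2 in
      (LArr r.1 r'.1, r'.2)
    else
      let r' := lab false B n in let r := lab true A r'.2 in
      (LArr r.1 r'.1, r.2)
  end.

Lemma lab_snd b A n : (lab b A n).2 = n + (natoms A).*2.
Proof. by elim: A b n => [|A IHA B IHB] [] n /=; rewrite ?IHA ?IHB; lia. Qed.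

Lemma lab_ty b A n : lty_ty (lab b A n).1 = A.
Proof. by elim: A b n => [|A IHA B IHB] [] n //=; rewrite ?IHA ?IHB. Qed.

Lemma lword_lab b A n :
  (if b then rev (lword (lab b A n).1) else lword (lab b A n).1) =
  iota n (natoms A).*2.
Proof.
elim: A b n => [|A IHA B IHB] [] n //=.
  rewrite rev_cat revK (IHA false) (IHB true) lab_snd -iotaD; congr iota; lia.
rewrite (IHA true) (IHB false) lab_snd -iotaD; congr iota; lia.
Qed.

Lemma lword_map (V W : Type) (f : V -> W) X : lword (lmap f X) = map f (lword X).
Proof. by elim: X => //= X IHX Y IHY; rewrite IHX IHY map_cat map_rev. Qed.

Lemma lty_ty_map (V W : Type) (f : V -> W) X : lty_ty (lmap f X) = lty_ty X.
Proof. by elim: X => //= X -> Y ->. Qed.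

(** Each atom takes two consecutive numbers, the first one even; reversal swaps them exactly when
    the polarity changes. *)
Lemma lab_oriented tag b A n : ~~ odd n ->
  oriented (tag (+) b) (lmap (pair tag) (lab b A n).1).
Proof.
move=> hn; elim: A tag b n hn => [|A IHA B IHB] tag [] n hn /=.
- by rewrite /source /= !(negPf hn) /=; case: tag.
- by rewrite /source /= !(negPf hn) /=; case: tag.
- have := IHA tag false n hn; have := IHB tag true (lab false A n).2.
  rewrite lab_snd oddD odd_double addbF hn addbF addbT negbK => -> // -> //.
- have := IHB tag false n hn; have := IHA tag true (lab false B n).2.
  by rewrite lab_snd oddD odd_double addbF hn addbF addbT => -> // -> //.
Qed.

Definition loc (A : ty) : lty nat := (lab false A 0).1.

Section Wires.
Variable C : finType.
Notation betas := (clos_refl_trans (term C) (@beta C)).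

Definition wire (X : lty nat) (t : term C) : wire_prop C :=
  fun W R e => real R [::] (lmap e X) t.

Definition no_wire : wire_prop C := fun _ _ _ => True.

Lemma wire_local X t : local (wire X t).
Proof.
move=> W W' h R R' e hR; rewrite /wire.
elim: X [::] t => [p m|X IHX Y IHY] l t /=.
  by split=> -[v h1 h2]; exists v => //; apply/hR.
by split=> H u cu hu; apply/IHY/H => //; apply/IHX.
Qed.

Lemma diag_id_wire X u t : oriented false (lmap (pair false) X) ->
  all (fun i => i < size u) (lword X) ->
  (forall i, i < size u -> is_plus (nth Plus u i) = ~~ odd i) ->
  transforms (diag_id C u) (wire X t) (wire X t).
Proof.
move=> oX bX par W R ed ec preR embR.
have fwd i : i < size u -> ~~ odd i -> R (ed i) [::] (ec i).
  move=> hi ev; apply: (embR (inl (Ordinal hi)) (inr (Ordinal hi))).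
  by rewrite ffunE /= par // ev.
have bwd i : i < size u -> odd i -> R (ec i) [::] (ed i).
  move=> hi od; apply: (embR (inr (Ordinal hi)) (inl (Ordinal hi))).
  by rewrite ffunE /= par // od.
(* Arrows exchange the two sides, so both directions are proved together; [b] tells on which side
   realizability is assumed. *)
suff: forall b l t, oriented b (lmap (pair false) X) ->
    real R l (lmap (if b then ec else ed) X) t ->
    real R l (lmap (if b then ed else ec) X) t by move/(_ false); apply.
elim: X bX {oX} => [p m|X IHX Y IHY] /=.
  case/and3P=> hp hm _ b l t' /andP[/eqP op /eqP om] [v hR hv]; exists v => //.
  have sandwich (w x y z : W) : R w [::] x -> R x (l ++ v) y ->
      R y [::] z -> R w (l ++ v) z.
    move=> h1 h2 h3; rewrite -[l ++ v]/([::] ++ (l ++ v)) -[l ++ v]cats0.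
    exact: (lp_trans preR) h1 (lp_trans preR h2 h3).
  move: op om; rewrite /source /=; case: b hR => /= hR op om.
    apply: sandwich hR _; [apply: fwd|apply: bwd] => //.
    by rewrite -[odd p]negbK op.
  apply: sandwich hR _; [apply: bwd|apply: fwd] => //.
  by rewrite -[odd m]negbK om.
rewrite all_cat all_rev => /andP[bY bX] b l t' /andP[oX oY] H u' cu hu.
apply: (IHY bY b) => //; apply: H => //.
by move: (IHX bX (~~ b) [::] u' oX); rewrite !if_neg; apply.
Qed.

Lemma lmap_comp (U V W : Type) (f : V -> W) (g : U -> V) X :
  lmap f (lmap g X) = lmap (fun i => f (g i)) X.
Proof. by elim: X => //= X -> Y ->. Qed.

Lemma edges_real u v (E : seq (ledge C)) k t X W R (ed ec : nat -> W) :
  reads k (embed t) [::] X [::] E -> nc (boundary u v) (arcs E) ->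
  closed_at 0 t -> labelled_preorder R -> embeds (edges_diag u v E) R ed ec ->
  real R [::] (lmap (fun p : vert => if p.1 then ec p.2 else ed p.2) X) t.
Proof.
move=> hE hn ct preR embR; set e := (fun p : vert => _).
pose R' p l q := R (e p) l (e q).
have preR' : labelled_preorder R'.
  by case: preR => r1 r2; split=> [p|p l q l' r]; [apply: r1|apply: r2].

apply/real_lmap.
apply: (reads_sound preR' hE _ (inst_embed R' t) ct (insts_nil R' t)).
have eE (p : vertex u v) : e (vert_of p) = ends_at ed ec p by case: p.
by move=> p q l /(edges_diag_mem hn)[p' [q' [<- <- /embR]]]; rewrite /R' !eE.
Qed.

Lemma edges_wire u v (E : seq (ledge C)) k t K1 K2 s :
  reads k (embed t) [::] (LArr (lmap (pair false) K1) (lmap (pair true) K2))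
    [::] E ->
  nc (boundary u v) (arcs E) -> closed_at 0 t -> closed_at 0 s ->
  transforms (edges_diag u v E) (wire K1 s) (wire K2 (App t s)).
Proof.
move=> hE hn ct cs W R ed ec preR embR hs.
have /= := edges_real hE hn ct preR embR.
by rewrite !lmap_comp /=; apply.
Qed.

Lemma edges_wire0 u v (E : seq (ledge C)) k t K :
  reads k (embed t) [::] (lmap (pair true) K) [::] E ->
  nc (boundary u v) (arcs E) -> closed_at 0 t ->
  transforms (edges_diag u v E) no_wire (wire K t).
Proof.
move=> hE hn ct W R ed ec preR embR _.
by have /= := edges_real hE hn ct preR embR; rewrite lmap_comp.
Qed.

End Wires.

(** * The transducer read off the terms *)

Definition dom (A : ty) : lty vert := lmap (@pair bool nat false) (loc A).
Definition cod (A : ty) : lty vert := lmap (@pair bool nat true) (loc A).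

Lemma lword_tag tag A : lword (lmap (@pair bool nat tag) (loc A)) =
  [seq (tag, i) | i <- iota 0 (size (alt (natoms A)))].
Proof. by rewrite lword_map /loc (lword_lab false) size_alt. Qed.

Section Assembly.
Variable C : finType.
Notation betas := (clos_refl_trans (term C) (@beta C)).

Lemma good_embed (t : term C) A : typed [::] t A ->
  good (embed t) /\ all oriented_leaf (leaves (embed t)).
Proof.
by case/typed_embed_closed=> _ h e; rewrite /good /xclosed e.
Qed.

Lemma read_arrow (t : term C) A B : typed [::] t (A -o B) -> exists k E,
  [/\ reads k (embed t) [::] (LArr (dom A) (cod B)) [::] E,
      nc (boundary (alt (natoms A)) (alt (natoms B))) (arcs E) &
      exists D : transdiag C (alt (natoms A)) (alt (natoms B)),
        td_diag D = edges_diag (alt (natoms A)) (alt (natoms B)) E].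
Proof.
move=> ht; have [gt ot] := good_embed ht.
have [xt _ lt] := typed_embed_closed ht.
have [|k [E hE]] := @reads_total _ _ [::] (LArr (dom A) (cod B)) [::] _ gt I xt.
  by rewrite /= !lty_ty_map !lab_ty; constructor.
have hn : nc (boundary (alt (natoms A)) (alt (natoms B))) (arcs E).
  by have := reads_nc hE gt I; rewrite lt /= rev_cat revK !lword_tag.
exists k, E; split=> //; apply: edges_transdiag hn _ => e.
apply: (reads_oriented hE) => //=; apply/andP; split.
  exact: (@lab_oriented false false).
exact: (@lab_oriented true false).
Qed.

Lemma read_closed (t : term C) A : typed [::] t A -> exists k E,
  [/\ reads k (embed t) [::] (cod A) [::] E,
      nc (boundary [::] (alt (natoms A))) (arcs E) &
      exists D : transdiag C [::] (alt (natoms A)),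
        td_diag D = edges_diag [::] (alt (natoms A)) E].
Proof.
move=> ht; have [gt ot] := good_embed ht.
have [xt _ lt] := typed_embed_closed ht.
have [|k [E hE]] := @reads_total _ _ [::] (cod A) [::] _ gt I xt.
  by rewrite /= !lty_ty_map !lab_ty; constructor.
have hn : nc (boundary [::] (alt (natoms A))) (arcs E).
  by have := reads_nc hE gt I; rewrite lt /= !lword_tag.
exists k, E; split=> //; apply: (@edges_transdiag _ 0) hn _ => e.
by apply: (reads_oriented hE) => //=; apply: (@lab_oriented true false).
Qed.

Lemma diag_id_oriented n : well_oriented (diag_id C (alt n)).
Proof.
move=> p q [l]; rewrite ffunE; case: p => i; case: ifP => h // [<- _] /=.
all: by rewrite h.
Qed.

(** Reachability inside one diagram. Vertices are named by their numbers, which is unambiguous here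
    because the domain will be empty. *)
Inductive dreach u v (D : diag C u v) : nat -> seq C -> nat -> Prop :=
| dreach_nil i : dreach D i [::] i
| dreach_cons p q l l' i : D p = Some (q, l) ->
    dreach D (ends_at id id q) l' i ->
    dreach D (ends_at id id p) (l ++ l') i.

Lemma dreach_pre u v (D : diag C u v) : labelled_preorder (dreach D).
Proof.
split; first exact: dreach_nil.
move=> p l q l' r h; elim: h l' r => // p' q' l1 l2 i hD _ IH l' r h'.
by rewrite -catA; apply: dreach_cons hD (IH _ _ h').
Qed.

(** The graph is now [D] itself. Its only possible edge goes from letter 1 to letter 0, so the path
    given by realizability is that single edge. *)
Lemma out_wire (D : diag C [::] [:: Plus; Minus]) t : well_oriented D ->
  transforms D (@no_wire C) (wire (LO 0 1) t) ->
  exists2 v, omap snd (D (inr ord_max)) = Some v & betas t (term_of_word v).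
Proof.
move=> oD tD; have embD : embeds D (dreach D) id id.
  by move=> p q l h; rewrite -[l]cats0; apply: dreach_cons h (dreach_nil _ _).
have [v hR hv] := tD _ _ _ _ (dreach_pre D) embD I; exists v => //.
have src p q l : D p = Some (q, l) ->
    ends_at id id p = 1 /\ p = inr ord_max /\ ends_at id id q = 0.
  move=> h; have [] := oD _ _ (ex_intro _ _ h).
  case: p h => [[]//|[[|[|i]] hi]] //= h _.
  case: q h => [[]//|[[|[|j]] hj]] //= h _; split=> //; split=> //.
  by congr inr; apply: val_inj.
have stop i l j : dreach D i l j -> i = 0 -> l = [::].
  by case=> // p q l1 l2 j' /src[-> _].
have go i l j : dreach D i l j -> i = 1 -> j = 0 ->
    omap snd (D (inr ord_max)) = Some l.
  case=> [_ -> //|p q l1 l2 j' h hr _ _].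
  have [_ [ep eq]] := src _ _ _ h.
  by rewrite -ep h /= (stop _ _ _ hr eq) cats0.
exact: go hR _ _.
Qed.

End Assembly.

Section Equivalence.
Variables (Sigma Gamma : finType) (T : lam_transducer Sigma Gamma).
Let k := lt_ty T.
Variables (Ei Eo : seq (ledge Gamma)) (Es : Sigma -> seq (ledge Gamma)).
Variables (ni no : nat) (ns : Sigma -> nat).
Hypothesis hi : reads ni (embed (lt_init T)) [::] (cod k) [::] Ei.
Hypothesis hs : forall a,
  reads (ns a) (embed (lt_step T a)) [::] (LArr (dom k) (cod k)) [::] (Es a).
Hypothesis ho :
  reads no (embed (lt_out T)) [::] (LArr (dom k) (cod TyO)) [::] Eo.
Let st := alt (natoms k).
Hypothesis nci : nc (boundary [::] st) (arcs Ei).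
Hypothesis ncs : forall a, nc (boundary st st) (arcs (Es a)).
Hypothesis nco : nc (boundary st (alt 1)) (arcs Eo).
Variables (Di : transdiag Gamma [::] st) (Ds : Sigma -> transdiag Gamma st st).
Variable Do : transdiag Gamma st (alt 1).
Hypothesis eDi : td_diag Di = edges_diag [::] st Ei.
Hypothesis eDs : forall a, td_diag (Ds a) = edges_diag st st (Es a).
Hypothesis eDo : td_diag Do = edges_diag st (alt 1) Eo.

Let T' := PRFT Di Ds Do.

Lemma prft_word_wire w t : closed_at 0 t ->
  well_oriented (prft_word T' w) /\
  transforms (prft_word T' w) (wire (loc k) t)
    (wire (loc k) (foldl (fun t a => App (lt_step T a) t) t w)).
Proof.
move=> ct; rewrite /prft_word.
have cs a := typed_closed_at (lt_stepP T a).
elim/last_ind: w => [|w a [ow tw]].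
  split=> /=; first exact: diag_id_oriented.
  apply: diag_id_wire; first exact: (@lab_oriented false false).
    rewrite (lword_lab false) /st size_alt; apply/allP => i.
    by rewrite mem_iota.
  by move=> i; rewrite size_alt => /nth_alt.
rewrite !foldl_rcons; split.
  by apply: well_oriented_comp => //; apply: td_oriented.
apply: (transforms_comp ow _ _ _ tw); try exact: wire_local.
  exact: td_oriented.
rewrite /= eDs; apply: edges_wire (hs a) (ncs a) (cs a) _.
by elim/last_ind: {ow tw} w => //= w b IH; rewrite foldl_rcons /= IH cs.
Qed.

Lemma prft_run w : exists2 v, prft_out T' w = Some v &
  clos_refl_trans _ (@beta Gamma) (lt_run T w) (term_of_word v).
Proof.
have ci := typed_closed_at (lt_initP T); have co := typed_closed_at (lt_outP T).
have [ow tw] := prft_word_wire w ci.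
have cw : closed_at 0 (foldl (fun t a => App (lt_step T a) t) (lt_init T) w).
  elim/last_ind: {ow tw} w => //= w b IH; rewrite foldl_rcons /= IH.
  by rewrite (typed_closed_at (lt_stepP T b)).
apply: out_wire.
  apply: well_oriented_comp; last exact: td_oriented.
  by apply: well_oriented_comp => //; apply: td_oriented.
apply: (@transforms_comp _ _ _ _ _ _ _
  (wire (loc k) (foldl (fun t a => App (lt_step T a) t) (lt_init T) w))).
- by apply: well_oriented_comp => //; apply: td_oriented.
- exact: td_oriented.
- by [].
- exact: wire_local.
- apply: transforms_comp tw => //; try exact: wire_local.
    exact: td_oriented.
  by rewrite /= eDi; apply: edges_wire0 hi nci ci.
- by rewrite /= eDo; apply: edges_wire ho nco co cw.
Qed.

Lemma prft_equivalent : equivalent T T'.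
Proof.
(* The default is never reached, as [prft_run] gives an output for every word. *)
exists (fun w => odflt [::] (prft_out T' w)); split=> w => [v|]; last first.
  by have [v -> _] := prft_run w.
have [v' -> /= hv'] := prft_run w.
have nf : lt_maps T w v' by split=> // u; apply: term_of_word_normal.
split=> [h|-> //].
exact: term_of_word_inj (normal_form_uniq h nf).
Qed.

End Equivalence.

(** * A program that computes it *)

Section Counting.
Variables (P : program) (M : nat).

(* The cost is bounded by counting the nodes of the evaluation, provided that no
   value is larger than [M]. *)
Inductive evn : seq tree -> expr -> tree -> nat -> Prop :=
| evn_var env i : evn env (EVar i) (nth Leaf env i) 1
| evn_leaf env : evn env ELeaf Leaf 1
| evn_node env e1 e2 x1 x2 n1 n2 :
    evn env e1 x1 n1 -> evn env e2 x2 n2 -> tree_size (Node x1 x2) <= M ->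
    evn env (ENode e1 e2) (Node x1 x2) (n1 + n2).+1
| evn_case_leaf env e e1 e2 x n n1 :
    evn env e Leaf n -> evn env e1 x n1 -> evn env (ECase e e1 e2) x (n + n1).+1
| evn_case_node env e e1 e2 y z x n n2 :
    evn env e (Node y z) n -> evn (y :: z :: env) e2 x n2 ->
    evn env (ECase e e1 e2) x (n + n2).+1
| evn_call env f e y x n n' :
    evn env e y n -> evn [:: y] (nth ELeaf P f) x n' ->
    evn env (ECall f e) x (n + n').+1.

(** Only [ENode] builds a tree, so its size check controls every value; each of the [n] evaluations
    then costs at most [M]. *)
Lemma evn_eval env e x n : evn env e x n -> 0 < M ->
  all (fun y => tree_size y <= M) env ->
  tree_size x <= M /\ exists2 c, eval P env e x c & c <= n * M.
Proof.
move=> h M0; elim: h => {env e x n}.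
- move=> env i henv.
  have hs : tree_size (nth Leaf env i) <= M.
    case: (ltnP i (size env)) => hi.
      by move/(all_nthP Leaf): henv => /(_ i hi).
    by rewrite nth_default.
  by split=> //; eexists; [constructor|rewrite mul1n].
- by move=> env _; split=> //; exists 1; [constructor|rewrite mul1n].
- move=> env e1 e2 x1 x2 n1 n2 _ IH1 _ IH2 hM henv; split=> //.
  have [[_ [c1 h1 b1]] [_ [c2 h2 b2]]] := (IH1 henv, IH2 henv).
  eexists; first exact: eval_node h1 h2.
  by rewrite mulSn mulnDl; lia.
- move=> env e e1 e2 x n1 n2 _ IH1 _ IH2 henv.
  have [[_ [c1 h1 b1]] [hs [c2 h2 b2]]] := (IH1 henv, IH2 henv); split=> //.
  eexists; first exact: eval_case_leaf h1 h2.
  by rewrite mulSn mulnDl; lia.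
- move=> env e e1 e2 y z x n1 n2 _ IH1 _ IH2 henv.
  have [hyz [c1 h1 b1]] := IH1 henv.
  have [|hs [c2 h2 b2]] := IH2.
    by rewrite /= henv andbT; apply/andP; move: hyz => /=; lia.
  split=> //; eexists; first exact: eval_case_node h1 h2.
  by rewrite mulSn mulnDl; lia.
- move=> env f e y x n1 n2 _ IH1 _ IH2 henv.
  have [hy [c1 h1 b1]] := IH1 henv.
  have [|hs [c2 h2 b2]] := IH2; first by rewrite /= hy.
  split=> //; eexists; first exact: eval_call h1 h2.
  by rewrite mulSn mulnDl; lia.
Qed.

Definition runs (f : nat) (y x : tree) (b : nat) : Prop :=
  exists2 n, evn [:: y] (nth ELeaf P f) x n & n <= b.

(** A weakest precondition that computes: a function body is executed symbolically by
    simplification, and a call is replaced by any specification of the callee. *)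
Fixpoint wp (env : seq tree) (e : expr) (Q : tree -> nat -> Prop) : Prop :=
  match e with
  | EVar i => Q (nth Leaf env i) 1
  | ELeaf => Q Leaf 1
  | ENode e1 e2 =>
    wp env e1 (fun x1 n1 => wp env e2 (fun x2 n2 =>
      tree_size (Node x1 x2) <= M /\ Q (Node x1 x2) (n1 + n2).+1))
  | ECase e e1 e2 =>
    wp env e (fun x n =>
      match x with
      | Leaf => wp env e1 (fun y m => Q y (n + m).+1)
      | Node y z => wp (y :: z :: env) e2 (fun y m => Q y (n + m).+1)
      end)
  | ECall f e =>
    wp env e (fun y n => exists x b, runs f y x b /\
      forall m, m <= b -> Q x (n + m).+1)
  end.

Lemma wp_evn env e Q : wp env e Q -> exists x n, evn env e x n /\ Q x n.
Proof.
elim: e env Q => [i||e1 IH1 e2 IH2|e IH e1 IH1 e2 IH2|f e IH] env Q /=.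
- by move=> h; do 2 eexists; split; [constructor|].
- by move=> h; do 2 eexists; split; [constructor|].
- move=> /IH1[x1 [n1 [h1 /IH2[x2 [n2 [h2 [hM hQ]]]]]]].
  by do 2 eexists; split; [apply: evn_node|]; eauto.
- move=> /IH[[|y z] [n [h]]].
    move=> /IH1[x [m [hx hQ]]]; do 2 eexists; split; last exact: hQ.
    exact: evn_case_leaf h hx.
  move=> /IH2[x [m [hx hQ]]]; do 2 eexists; split; last exact: hQ.
  exact: evn_case_node h hx.
- move=> /IH[y [n [h [x [b [[m hm le_m] hQ]]]]]].
  by do 2 eexists; split; [apply: evn_call h hm|apply: hQ].
Qed.

Lemma wp_runs f y x b :
  wp [:: y] (nth ELeaf P f) (fun x' n => x' = x /\ n <= b) -> runs f y x b.
Proof. by case/wp_evn=> x' [n [h [<- hn]]]; exists n. Qed.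

End Counting.

(* Program texts are written with named variables: an expression is given as a
   function of the length of its environment, and a variable by its level. *)
Definition dexpr : Type := nat -> expr.

Definition dvar (k : nat) : dexpr := fun d => EVar (d - k).
Definition dleaf : dexpr := fun _ => ELeaf.
Definition dnode (e1 e2 : dexpr) : dexpr := fun d => ENode (e1 d) (e2 d).
Definition dcall (f : nat) (e : dexpr) : dexpr := fun d => ECall f (e d).
(** A case pushes the left subtree last, at index 0, hence at the higher level [d.+2]. *)
Definition dmatch (e e1 : dexpr) (e2 : dexpr -> dexpr -> dexpr) : dexpr :=
  fun d => ECase (e d) (e1 d) (e2 (dvar d.+2) (dvar d.+1) d.+2).
Definition dsplit (e : dexpr) (e2 : dexpr -> dexpr -> dexpr) : dexpr :=
  dmatch e dleaf e2.
Definition dfun (body : dexpr -> dexpr) : expr := body (dvar 1) 1.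

Declare Scope dexpr_scope.
Delimit Scope dexpr_scope with D.
Bind Scope dexpr_scope with dexpr.
Notation "e1 '&,' e2" := (dnode e1 e2)
  (at level 60, right associativity) : dexpr_scope.
Notation "'\let' ( x , y ) := e 'in' f" := (dsplit e (fun x y => f))
  (at level 200, x name, y name, e at level 90, f at level 200) : dexpr_scope.
Notation "'\case' e 'of' '|' 'leaf' => e1 '|' ( x , y ) => f" :=
  (dmatch e e1 (fun x y => f))
  (at level 200, x name, y name, e at level 90, e1 at level 90, f at level 200)
  : dexpr_scope.

Local Open Scope dexpr_scope.

Fixpoint dnat (n : nat) : dexpr := if n is n.+1 then dleaf &, dnat n else dleaf.

Definition idx_eq := 1.
Definition idx_subst := 2.
Definition idx_rcons := 3.
Definition idx_loop := 4.
Definition idx_lab := 5.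
Definition idx_lookup := 6.
Definition idx_build := 7.
Definition idx_signs := 8.
Definition idx_diag := 9.
Definition idx_steps := 10.

Definition body_eq : expr := Eval compute in dfun (fun arg =>
  \let (x, y) := arg in
  \case x of
  | leaf => (\case y of | leaf => dnat 1 | (y1, y2) => dleaf)
  | (x1, x2) =>
    \case y of
    | leaf => dleaf
    | (y1, y2) =>
      \case dcall idx_eq (x1 &, y1) of
      | leaf => dleaf
      | (z1, z2) => dcall idx_eq (x2 &, y2)).

Definition body_subst : expr := Eval compute in dfun (fun arg =>
  \let (j, arg1) := arg in \let (s, t) := arg1 in \let (tag, c) := t in
  \case tag of
  | leaf => (\case dcall idx_eq (c &, j) of | leaf => t | (z1, z2) => s)
  | (z1, tag1) =>
    \case tag1 of
    | leaf => tag &, dcall idx_subst ((dleaf &, j) &, s &, c)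
    | (z1, tag2) =>
      \case tag2 of
      | leaf => (\let (t1, t2) := c in
          tag &, dcall idx_subst (j &, s &, t1) &, dcall idx_subst (j &, s &, t2))
      | (z1, tag3) => t).

Definition body_rcons : expr := Eval compute in dfun (fun arg =>
  \let (l, a) := arg in
  \case l of
  | leaf => a &, dleaf
  | (b, l1) => b &, dcall idx_rcons (l1 &, a)).

(** The rules of [reads] with an accumulator of edges. For [reads_ne] the inner call reads the rest
    and its result is the accumulator for the argument, which yields [E ++ E']. *)
Definition body_loop : expr := Eval compute in dfun (fun arg =>
  \let (t, arg1) := arg in \let (S, arg2) := arg1 in \let (X, arg3) := arg2 in
  \let (l, acc) := arg3 in \let (tag, c) := t in
  let eta := (\let (k, X12) := X in \let (X1, X2) := X12 in
    dcall idx_loop (t &, ((dnat 5 &, X1) &, dleaf) &, X2 &, l &, acc)) in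
  \case tag of
  | leaf => dleaf
  | (z, tag1) =>
  \case tag1 of
  | leaf => (\case S of
    | leaf => eta
    | (u, S1) =>
      dcall idx_loop (dcall idx_subst (dleaf &, u &, c) &, S1 &, X &, l &, acc))
  | (z, tag2) =>
  \case tag2 of
  | leaf => (\let (t1, t2) := c in
      dcall idx_loop (t1 &, (t2 &, S) &, X &, l &, acc))
  | (z, tag3) =>
  \case tag3 of
  | leaf => (\case S of
    | leaf => eta
    | (u, S1) =>
      dcall idx_loop (u &, dleaf &, X &, dcall idx_rcons (l &, c) &, acc))
  | (z, tag4) =>
  \case tag4 of
  | leaf => (\let (k, pm) := X in \let (p, m) := pm in (m &, p &, l) &, acc)
  | (z, tag5) =>
    \let (k, Y) := c in \let (Y1, Y2) := Y in
    \case k of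
    | leaf => (\let (k1, pm) := X in \let (p, m) := pm in
        (m &, Y2 &, l) &, (Y1 &, p &, dleaf) &, acc)
    | (z1, z2) =>
      \case S of
      | leaf => eta
      | (u, S1) => dcall idx_loop (u &, dleaf &, Y1 &, dleaf &,
          dcall idx_loop ((tag &, Y2) &, S1 &, X &, l &, acc))).

Definition body_lab : expr := Eval compute in dfun (fun arg =>
  \let (g, arg1) := arg in \let (b, arg2) := arg1 in \let (A, n) := arg2 in
  \case A of
  | leaf =>
    (\case b of
    | leaf => ((dleaf &, (g &, n) &, (g &, dleaf &, n)) &, dleaf &, dleaf &, n)
    | (z1, z2) =>
      ((dleaf &, (g &, dleaf &, n) &, (g &, n)) &, dleaf &, dleaf &, n))
  | (A1, A2) =>
    \case b of
    | leaf =>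
      (\let (X2, n2) := dcall idx_lab (g &, dleaf &, A2 &, n) in
       \let (X1, n1) := dcall idx_lab (g &, dnat 1 &, A1 &, n2) in
       (dnat 1 &, X1 &, X2) &, n1)
    | (z1, z2) =>
      \let (X1, n1) := dcall idx_lab (g &, dleaf &, A1 &, n) in
      \let (X2, n2) := dcall idx_lab (g &, dnat 1 &, A2 &, n1) in
      (dnat 1 &, X1 &, X2) &, n2).

Definition body_lookup : expr := Eval compute in dfun (fun arg =>
  \let (v, E) := arg in
  \case E of
  | leaf => dleaf
  | (e, E1) =>
    \let (v1, r) := e in
    \case dcall idx_eq (v1 &, v) of
    | leaf => dcall idx_lookup (v &, E1)
    | (z1, z2) => dleaf &, r).

Definition body_build : expr := Eval compute in dfun (fun arg =>
  \let (g, arg1) := arg in \let (n, arg2) := arg1 in \let (E, acc) := arg2 in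
  \case n of
  | leaf => acc
  | (z, n1) => dcall idx_build (g &, n1 &, E &,
      dcall idx_lookup ((g &, n1) &, E) &, acc)).

Definition body_signs : expr := Eval compute in dfun (fun n =>
  \case n of
  | leaf => dleaf
  | (z, n1) => \let (z1, n2) := n1 in dleaf &, dnat 1 &, dcall idx_signs n2).

(** Pairing with a leaf and splitting at once acts as a local definition: the edges are computed
    once and used twice. *)
Definition body_diag : expr := Eval compute in dfun (fun arg =>
  \let (t, arg1) := arg in \let (X, arg2) := arg1 in \let (m, n) := arg2 in
  \let (E, z) := dcall idx_loop (t &, dleaf &, X &, dleaf &, dleaf) &, dleaf in
  dcall idx_build (dleaf &, m &, E &, dleaf) &,
  dcall idx_build (dnat 1 &, n &, E &, dleaf)).

Definition body_steps : expr := Eval compute in dfun (fun arg =>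
  \let (ts, arg1) := arg in \let (X, n) := arg1 in
  \case ts of
  | leaf => dleaf
  | (t, ts1) => dcall idx_diag (t &, X &, n &, n) &, dcall idx_steps (ts1 &, X &, n)).

Definition body_main : expr := Eval compute in dfun (fun arg =>
  \let (A, arg1) := arg in \let (ds, arg2) := arg1 in \let (i, o) := arg2 in
  \let (Xd, n) := dcall idx_lab (dleaf &, dleaf &, A &, dleaf) in
  \let (Xc, n1) := dcall idx_lab (dnat 1 &, dleaf &, A &, dleaf) in
  dcall idx_signs n &,
  dcall idx_diag (i &, Xc &, dleaf &, n) &,
  dcall idx_steps (ds &, (dnat 1 &, Xd &, Xc) &, n) &,
  dcall idx_diag (o &,
    (dnat 1 &, Xd &, dleaf &, (dnat 1 &, dleaf) &, (dnat 1 &, dnat 1)) &,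
    n &, dnat 2)).

Definition prog : program :=
  [:: body_main; body_eq; body_subst; body_rcons; body_loop; body_lab;
      body_lookup; body_build; body_signs; body_diag; body_steps].

(** * Correctness and cost of the functions of the program *)

Fixpoint tree_eq (x y : tree) : bool :=
  match x, y with
  | Leaf, Leaf => true
  | Node x1 x2, Node y1 y2 => tree_eq x1 y1 && tree_eq x2 y2
  | _, _ => false
  end.

Lemma tree_eq_nat i j : tree_eq (code_nat i) (code_nat j) = (i == j).
Proof. by elim: i j => [|i IH] [|j] //=; rewrite IH. Qed.

Lemma tree_eq_vert p q : tree_eq (code_vert p) (code_vert q) = (p == q).
Proof.
by case: p q => [b i] [b' j]; rewrite /= tree_eq_nat; case: b; case: b'.
Qed.

Ltac eval_call h := eexists; eexists; split; [apply: h|].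
Ltac size_lia :=
  repeat match goal with H : is_true (_ <= _) |- _ => move: H end => /=; lia.
Ltac size_conds := repeat (split; [by size_lia|]).
Ltac eval_done := size_conds; split; [by []|size_lia].

Section Specs.
Variable M : nat.
Notation runs := (runs prog M).

Lemma run_eq x y : tree_size x + tree_size y < M ->
  runs idx_eq (Node x y) (code_tag (tree_eq x y)) (20 * tree_size x).
Proof.
elim: x y => [|x1 IH1 x2 IH2] [|y1 y2] hM; apply: wp_runs => /=; try by eval_done.
size_conds; eval_call IH1; first by size_lia.
move=> m hm; case: (tree_eq x1 y1) => /=; last by eval_done.
size_conds; eval_call IH2; first by size_lia.
by move=> m' hm'; eval_done.
Qed.

Section Letters.
Variable C : finType.
Implicit Types (t u : term C) (x y : xterm C) (l : seq C).
Notation code_word := (code_seq (@code_letter C)).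
Notation code_stack := (code_seq (@code_xterm C)).

Lemma size_xsubst j x y : tree_size (code_xterm (xsubst j y x)) <=
  tree_size (code_xterm x) +
  count (is_var j) (leaves x) * tree_size (code_xterm y).
Proof.
elim: x j => [i|x IH|x IHx z IHz|a||X] j; rewrite /=; try lia.
- by case: eqP => _ /=; lia.
- by have := IH j.+1; rewrite count_down1; lia.
- by rewrite count_cat; have := (IHx j, IHz j) => -[]; lia.
Qed.

(** One copy of [y] is counted for each occurrence, plus the one carried in the argument of the
    call. *)
Lemma run_subst j y x :
  tree_size (code_nat j) + 2 * tree_size (code_xterm x) +
    (count (is_var j) (leaves x)).+1 * tree_size (code_xterm y) + 20 <= M ->
  runs idx_subst (Node (code_nat j) (Node (code_xterm y) (code_xterm x)))
    (code_xterm (xsubst j y x)) (100 * tree_size (code_xterm x)).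
Proof.
elim: x j => [i|x IH|x IHx z IHz|a||X] j hM; apply: wp_runs => /=.
- size_conds; eval_call run_eq; first by size_lia.
  by rewrite tree_eq_nat => m hm; case: eqP => /= _; eval_done.
- have := size_xsubst j.+1 x y; move: hM; rewrite /= count_down1 => hM hs.
  size_conds; eval_call (IH j.+1); first by size_lia.
  by move=> m hm; eval_done.
- have := (size_xsubst j x y, size_xsubst j z y); move: hM.
  rewrite /= count_cat => hM [hx hz].
  size_conds; eval_call (IHx j); first by size_lia.
  move=> m hm; size_conds; eval_call (IHz j); first by size_lia.
  by move=> m' hm'; eval_done.
- by eval_done.
- by eval_done.
- by eval_done.
Qed.

Lemma run_rcons l a :
  tree_size (code_word l) + tree_size (code_letter a) + 1 < M ->
  runs idx_rcons (Node (code_word l) (code_letter a)) (code_word (rcons l a))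
    (20 * tree_size (code_word l)).
Proof.
elim: l => [|b l IH] hM; apply: wp_runs => /=; first by eval_done.
size_conds; eval_call IH; first by size_lia.
have hs := size_code_rcons l a.
by move=> m hm; eval_done.
Qed.

Lemma size_code_stack (S : seq (xterm C)) :
  tree_size (code_stack S) <= wstack S.
Proof. by elim: S => //= y S IH; have := size_code_xterm y; lia. Qed.

Lemma run_loop n x S X l E acc : reads n x S X l E -> good x -> goods S ->
  4 * wtask x S X l + tree_size (code_edges acc) + 100 <= M ->
  runs idx_loop (Node (code_xterm x) (Node (code_stack S) (Node (code_lty X)
    (Node (code_word l) (code_edges acc)))))
    (code_edges (E ++ acc)) (n * (300 * M)).
Proof.
move=> h; set B := 300 * M; elim: h acc => {n x S X l E}.
- move=> n x y S X l E _ IH acc /good_app[gx gy] gS.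
  have := (size_code_xterm x, size_code_xterm y, size_code_stack S).
  move=> [[hx hy] hS]; have hX := size_code_lty X.
  rewrite /wtask => /= hM; apply: wp_runs => /=; size_conds.
  eval_call (IH acc gx (conj gy gS)); first by rewrite /wtask; size_lia.
  by move=> m hm; split=> //; rewrite mulSn /B; size_lia.
- move=> n x X Y l E ex _ IH acc gx gS.
  have [hX hY] := (size_code_lty X, size_code_lty Y).
  have hx := size_code_xterm x.
  rewrite /wtask => /= hM; apply: wp_runs.
  case: x ex IH gx hx hM => // [x|a|[//|Y1 Y2]] _ IH gx hx hM /=; size_conds.
  + eval_call (IH acc gx (conj (good_ne C X) gS)); first by rewrite /wtask; size_lia.
    by move=> m hm; split=> //; rewrite mulSn /B; size_lia.
  + eval_call (IH acc gx (conj (good_ne C X) gS)); first by rewrite /wtask; size_lia.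
    by move=> m hm; split=> //; rewrite mulSn /B; size_lia.
  + eval_call (IH acc gx (conj (good_ne C X) gS)); first by rewrite /wtask; size_lia.
    by move=> m hm; split=> //; rewrite mulSn /B; size_lia.
- move=> n x y S X l E _ IH acc gx [gy gS].
  have := (size_code_xterm x, size_code_xterm y, size_code_stack S).
  move=> [[hx hy] hS]; have hX := size_code_lty X.
  (* Affinity again: the space taken by the substitution is at most two copies of [y]. *)
  have c0 : count (is_var 0) (leaves x) <= 1.
    case: gx.2 => -[s [/negPf h0 e]] _.
    have c0 : count (is_var 0) s = 0.
      by apply/eqP; rewrite -leqn0 leqNgt -has_count h0.
    by case: e => ->; rewrite -?cats1 ?count_cat c0.
  have hs := size_xsubst 0 x y.
  have hm : count (is_var 0) (leaves x) * tree_size (code_xterm y) <=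
    tree_size (code_xterm y) by rewrite -[leqRHS]mul1n leq_mul2r c0 orbT.
  have hw := wterm_beta y gx.2.
  rewrite /wtask => /= hM; apply: wp_runs => /=; size_conds.
  eval_call (@run_subst 0); first by rewrite mulSn; size_lia.
  move=> m1 hm1; size_conds.
  eval_call (IH acc (good_beta gx gy) gS); first by rewrite /wtask; size_lia.
  by move=> m hm2; split=> //; rewrite mulSn /B; size_lia.
- move=> n a y p m l E _ IH acc _ [gy _].
  have hy := size_code_xterm y; have hl := size_code_rcons l a.
  rewrite /wtask => /= hM; apply: wp_runs => /=; size_conds.
  eval_call run_rcons; first by size_lia.
  move=> m1 hm1; size_conds.
  eval_call (IH acc gy I); first by rewrite /wtask; size_lia.
  by move=> m2 hm2; split=> //; rewrite mulSn /B; size_lia.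
- move=> p m l acc _ _; rewrite /wtask => /= hM; apply: wp_runs => /=.
  by size_conds; split=> //; rewrite mul1n /B; size_lia.
- move=> n n' y Y1 Y2 S X l E E' hE IH1 hE' IH2 acc _ [gy gS].
  (* [E'] joins the accumulator of the outer call, so its size has to be covered by the weight. *)
  have [_ hs'] := reads_bound hE' (good_ne C Y2) gS; move: hs'.
  have hcat := size_code_cat E' acc.
  have := (size_code_xterm y, size_code_stack S) => -[hy hS].
  have := (size_code_lty X, size_code_lty Y1, size_code_lty Y2).
  move=> [[hX hY1] hY2].
  rewrite /wtask => /= hs' hM; apply: wp_runs => /=; size_conds.
  eval_call (IH2 acc (good_ne C Y2) gS); first by rewrite /wtask; size_lia.
  move=> m1 hm1; size_conds.
  eval_call (IH1 (E' ++ acc) gy I); first by rewrite /wtask; size_lia.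
  by move=> m2 hm2; rewrite catA; split=> //; rewrite mulSn mulnDl /B; size_lia.
- move=> p' m' p m l acc _ _; rewrite /wtask => /= hM; apply: wp_runs => /=.
  by size_conds; split=> //; rewrite mul1n /B; size_lia.
Qed.

End Letters.
End Specs.

Lemma natoms_code A : natoms A <= tree_size (code_ty A).
Proof. by elim: A => //= A IHA B IHB; lia. Qed.

Lemma size_code_vert g i : tree_size (code_vert (g, i)) <= i.*2 + 5.
Proof. by rewrite /= tree_size_code_nat; case: g => /=; lia. Qed.

(** The [+ 20] makes the bound additive: it is the 20 that an arrow adds when it joins two types.
    [U] bounds all the numbers in use. *)
Lemma wlty_lab g b A n U : n + (natoms A).*2 <= U ->
  wlty (lmap (pair g) (lab b A n).1) + 20 <= natoms A * (4 * U + 50).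
Proof.
elim: A b n => [|A IHA B IHB] b n.
  move=> h; have := (size_code_vert g n, size_code_vert g n.+1) => -[h1 h2].
  by move: h h1 h2; case: b; rewrite /natoms mul1n /=; lia.
have := (IHA (~~ b), IHB b) => -[hA hB].
rewrite /natoms -/natoms mulnDl => h; case: b hA hB => /= hA hB.
  have := hA n; have := hB (lab false A n).2; rewrite lab_snd; lia.
have := hB n; have := hA (lab false B n).2; rewrite lab_snd; lia.
Qed.

Section Specs.
Variable M : nat.
Notation runs := (runs prog M).

Lemma run_lab g b A n U : n + (natoms A).*2 <= U ->
  natoms A * (4 * U + 50) + 4 * U + 2 * tree_size (code_ty A) + 100 <= M ->
  runs idx_lab (Node (code_tag g) (Node (code_tag b) (Node (code_ty A) (code_nat n))))
    (Node (code_lty (lmap (pair g) (lab b A n).1)) (code_nat (lab b A n).2))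
    (100 * tree_size (code_ty A)).
Proof.
have tag3 (c : bool) : tree_size (code_tag c) <= 3 by case: c.
have tg := tag3 g.
elim: A b n => [|A IHA B IHB] b n hU hM.
  have := (size_code_vert g n, size_code_vert g n.+1) => -[h1 h2].
  have hn := tree_size_code_nat n; move: hM; rewrite /natoms mul1n => hM.
  move: hU h1 h2 hn hM; rewrite /natoms => hU h1 h2 hn hM.
  by apply: wp_runs; case: b => /=; eval_done.
have hX := wlty_lab g b hU.
have hs := size_code_lty (lmap (pair g) (lab b (A -o B) n).1).
have hn : tree_size (code_nat (lab b (A -o B) n).2) <= (2 * U).+1.
  by rewrite tree_size_code_nat lab_snd; lia.
have n0 := tree_size_code_nat n.
move: hU hM hX hs; rewrite /natoms -/natoms mulnDl => hU hM hX hs.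
case: b hX hs hn => /= hX hs hn; apply: wp_runs => /=; size_conds.
- have n1 : tree_size (code_nat (lab false A n).2) <= (2 * U).+1.
    by rewrite tree_size_code_nat lab_snd; lia.
  eval_call (IHA false n); [by size_lia|by size_lia|].
  move=> m hm; size_conds.
  eval_call (IHB true); [by rewrite lab_snd; size_lia|by size_lia|].
  by move=> m' hm'; eval_done.
- have n1 : tree_size (code_nat (lab false B n).2) <= (2 * U).+1.
    by rewrite tree_size_code_nat lab_snd; lia.
  eval_call (IHB false n); [by size_lia|by size_lia|].
  move=> m hm; size_conds.
  eval_call (IHA true); [by rewrite lab_snd; size_lia|by size_lia|].
  by move=> m' hm'; eval_done.
Qed.

Lemma run_signs k : 6 * k + 20 <= M ->
  runs idx_signs (code_nat k.*2) (code_seq code_sign (alt k)) (20 * k + 5).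
Proof.
elim: k => [|k IH] hM; apply: wp_runs => /=; first by eval_done.
size_conds; eval_call IH; first by size_lia.
have hs : tree_size (code_seq code_sign (alt k)) = 6 * k + 1.
  by elim: k {IH hM} => //= k ->; lia.
by move=> m hm; eval_done.
Qed.

Section Letters.
Variable C : finType.
Notation code_word := (code_seq (@code_letter C)).
Implicit Types (E : seq (ledge C)).

Definition code_from E (v : vert) : tree :=
  code_option (code_pair code_vert code_word) (lookup v E).

Lemma run_lookup v E :
  tree_size (code_vert v) + tree_size (code_edges E) + 10 <= M ->
  runs idx_lookup (Node (code_vert v) (code_edges E)) (code_from E v)
    (100 * tree_size (code_edges E)).
Proof.
rewrite /code_from; elim: E => [|[v1 [q l]] E IH] hM; apply: wp_runs => /=.
  by eval_done.
move: hM; rewrite [code_edges _]/= [code_edge _]/= => hM; size_conds.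
eval_call run_eq; first by size_lia.
rewrite tree_eq_vert => m hm; case: eqP => /= _; last first.
  size_conds; eval_call IH; first by size_lia.
  by move=> m' hm'; eval_done.
by eval_done.
Qed.

Lemma size_code_from E v : tree_size (code_from E v) <= tree_size (code_edges E).
Proof.
rewrite /code_from; elim: E => //= -[v1 [q l]] E IH /=.
by case: eqP => _ /=; lia.
Qed.

Lemma size_code_froms E (g : bool) s :
  tree_size (code_seq (fun i => code_from E (g, i)) s) <=
  size s * (tree_size (code_edges E)).+1 + 1.
Proof.
by elim: s => //= i s IH; have := size_code_from E (g, i); rewrite mulSn; lia.
Qed.

Definition code_edges_diag E (m n : nat) : tree :=
  Node (code_seq (fun i => code_from E (false, i)) (iota 0 m))
    (code_seq (fun j => code_from E (true, j)) (iota 0 n)).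

Lemma size_code_edges_diag E m n : tree_size (code_edges_diag E m n) <=
  m * (tree_size (code_edges E)).+1 + n * (tree_size (code_edges E)).+1 + 3.
Proof.
have := size_code_froms E true (iota 0 n).
have := size_code_froms E false (iota 0 m).
by rewrite !size_iota /=; lia.
Qed.

(** The table made by [lookup] is the code of the diagram because all targets are on the boundary,
    so that [of_vert] never fails. *)
Lemma code_diag_edges u v E : nc (boundary u v) (arcs E) ->
  code_diag (edges_diag u v E) = code_edges_diag E (size u) (size v).
Proof.
move=> hn.
have enumE n (F : 'I_n -> tree) (G : nat -> tree) :
    (forall i, F i = G (val i)) ->
    code_seq F (enum 'I_n) = code_seq G (iota 0 n).
  move=> h; rewrite -val_enum_ord; elim: (enum _) => //= i s ->.
  by rewrite h.
rewrite /code_diag /code_edges_diag.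
have codeE (p : vertex u v) : code_option (code_pair (@code_vertex u v) code_word)
    (edges_diag u v E p) = code_from E (vert_of p).
  rewrite /code_from ffunE; case e: (lookup _ _) => [[q l]|] //.
  have : (vert_of p, q) \in arcs E.
    by apply/mapP; exists (vert_of p, (q, l)); rewrite ?(lookup_mem e).
  case/(nc_mem hn) => _ /boundary_of_vert[q' <-].
  by rewrite vert_ofK /=; case: q' => i.
by congr Node; apply: enumE => i; apply: codeE.
Qed.

Lemma run_build g n E s :
  (n + size s) * (tree_size (code_edges E)).+1 + 2 * tree_size (code_edges E) +
    4 * n + 40 <= M ->
  runs idx_build (Node (code_tag g) (Node (code_nat n) (Node (code_edges E)
      (code_seq (fun i => code_from E (g, i)) s))))
    (code_seq (fun i => code_from E (g, i)) (iota 0 n ++ s)) (n * (200 * M) + 10).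
Proof.
have tg : tree_size (code_tag g) <= 3 by case: g.
set B := 200 * M; elim: n s => [|n IH] s hM; first by apply: wp_runs => /=; eval_done.
have hv := size_code_vert g n; have hn := tree_size_code_nat n.
have hs := size_code_froms E g (n :: s).
have IH' := IH (n :: s); move: IH' hM hs; rewrite [size (n :: s)]/= addSnnS.
rewrite mulnDl; set e := (size s).+1 * _; set e' := n * _ => IH' hM hs.
have -> : iota 0 n.+1 ++ s = iota 0 n ++ n :: s.
  by rewrite -addn1 iotaD -catA.
apply: wp_runs => /=; size_conds; eval_call (@run_lookup (g, n)); first by size_lia.
move=> m hm; move: hs => /= hs; size_conds; eval_call IH'; first by size_lia.
by move=> m' hm'; split=> //; rewrite mulSn /B; size_lia.
Qed.

Lemma run_diag (t : term C) X E k m n N W :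
  reads k (embed t) [::] X [::] E -> good (embed t) ->
  wtask (embed t) [::] X [::] <= W -> m <= N -> n <= N ->
  4 * (N * W.+1) + 10 * W + 10 * N + 200 <= M ->
  runs idx_diag
    (Node (code_term t) (Node (code_lty X) (Node (code_nat m) (code_nat n))))
    (code_edges_diag E m n) ((W + N) * (1000 * M)).
Proof.
move=> hE gt hW hm hn hM.
have [hk he] := reads_bound hE gt I.
have hB p : p <= N -> p * (tree_size (code_edges E)).+1 <= N * W.+1.
  by move=> hp; apply: leq_mul => //; apply: leq_trans hW.
have [h1 h2] := (hB _ hm, hB _ hn).
have [h3 h4] := (tree_size_code_nat m, tree_size_code_nat n).
have f1 := size_code_froms E false (iota 0 m).
have f2 := size_code_froms E true (iota 0 n).
move: h1 h2 hM f1 f2; rewrite !size_iota.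
set e1 := m * _; set e2 := n * _; set e := N * _ => h1 h2 hM f1 f2.
have := size_code_xterm (embed t); rewrite code_embed => ht.
have hX := size_code_lty X; move: (hW); rewrite {1}/wtask => /= hW'.
have k1 : k * (300 * M) <= W * (300 * M) by rewrite leq_mul2r (leq_trans hk hW) orbT.
have k2 : m * (200 * M) <= N * (200 * M) by rewrite leq_mul2r hm orbT.
have k3 : n * (200 * M) <= N * (200 * M) by rewrite leq_mul2r hn orbT.
apply: wp_runs => /=; size_conds.
have hl := @run_loop M _ _ _ _ _ _ _ [::] hE gt I; rewrite code_embed cats0 in hl.
eval_call hl; first by size_lia.
move=> m1 hm1; size_conds.
have hb1 := @run_build false m E [::]; rewrite cats0 in hb1.
eval_call hb1; first by rewrite addn0; size_lia.
move=> m2 hm2; size_conds.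
have hb2 := @run_build true n E [::]; rewrite cats0 in hb2.
eval_call hb2; first by rewrite addn0; size_lia.
move=> m3 hm3; size_conds; split=> //.
(* As [W] is positive, [W * M] absorbs the additive constants. *)
have k4 : M <= W * M by rewrite leq_pmull //; lia.
have {}hm1 := leq_trans hm1 k1.
have {}hm2 : m2 <= N * (200 * M) + 10 by apply: leq_trans hm2 _; rewrite leq_add2r.
have {}hm3 : m3 <= N * (200 * M) + 10 by apply: leq_trans hm3 _; rewrite leq_add2r.
have M1 : 100 <= M by lia.
clear - k4 hm1 hm2 hm3 M1; move: k4 hm1 hm2 hm3.
rewrite mulnDl (mulnCA W 300) (mulnCA N 200) (mulnCA W 1000) (mulnCA N 1000).
by move: (W * M) (N * M) => a b; lia.
Qed.

Lemma size_code_diag (x : xterm C) X E k m n N W :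
  reads k x [::] X [::] E -> good x -> wtask x [::] X [::] <= W ->
  m <= N -> n <= N ->
  tree_size (code_edges_diag E m n) <= 2 * (N * W.+1) + 3.
Proof.
move=> hE gx hW hm hn; have [_ he] := reads_bound hE gx I.
have hB p : p <= N -> p * (tree_size (code_edges E)).+1 <= N * W.+1.
  by move=> hp; apply: leq_mul => //; apply: leq_trans hW.
have := size_code_edges_diag E m n; have := (hB _ hm, hB _ hn) => -[].
by move: (N * _) => q; lia.
Qed.

Lemma size_code_diags (A : Type) (x : A -> xterm C) X (Es : A -> seq (ledge C))
    (ns : A -> nat) n N W s :
  (forall a, reads (ns a) (x a) [::] X [::] (Es a)) ->
  (forall a, good (x a)) -> (forall a, wtask (x a) [::] X [::] <= W) -> n <= N ->
  tree_size (code_seq (fun a => code_edges_diag (Es a) n n) s) <=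
  size s * (2 * (N * W.+1) + 4) + 1.
Proof.
move=> hE gx hW hn; elim: s => // b r IH.
have := size_code_diag (hE b) (gx b) (hW b) hn hn.
rewrite [size _]/= (mulSn (size r)); move: IH; move: (size r * _) => e.
have -> : tree_size (code_seq (fun a => code_edges_diag (Es a) n n) (b :: r)) =
  (tree_size (code_edges_diag (Es b) n n) + tree_size (code_seq
    (fun a => code_edges_diag (Es a) n n) r)).+1 by [].
by move: (N * _) => q; lia.
Qed.

Lemma run_steps (A : Type) (d : A -> term C) X (Es : A -> seq (ledge C))
    (ns : A -> nat) n N W s :
  (forall a, reads (ns a) (embed (d a)) [::] X [::] (Es a)) ->
  (forall a, good (embed (d a))) ->
  (forall a, wtask (embed (d a)) [::] X [::] <= W) -> n <= N ->
  (size s).+1 * (4 * (N * W.+1) + 10 * W + 10 * N + 200) +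
    tree_size (code_seq (fun a => code_term (d a)) s) <= M ->
  runs idx_steps (Node (code_seq (fun a => code_term (d a)) s)
      (Node (code_lty X) (code_nat n)))
    (code_seq (fun a => code_edges_diag (Es a) n n) s)
    ((size s).+1 * ((W + N) * (1000 * M) + 100)).
Proof.
move=> hE gd hW hn; set B := _ + 100; set K := _ + 200.
have hs r : tree_size (code_seq (fun a => code_edges_diag (Es a) n n) r) <=
    size r * K + 1.
  apply: leq_trans (size_code_diags r hE gd hW hn) _.
  by rewrite leq_add2r leq_mul2l /K; move: (N * _) => q; lia.
elim: s => [|a s IH] hM.
  apply: wp_runs => /=; split=> //; rewrite mul1n /B; lia.
have {}hs := hs (a :: s).
have [hwa hn0] := (hW a, tree_size_code_nat n).
have ht := size_code_xterm (embed (d a)); rewrite code_embed in ht.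
have hX := size_code_lty X; move: hwa; rewrite /wtask => /= hwa.
move: hM hs; rewrite [size (a :: s)]/= mulSn => hM hs.
have hK : 4 * (N * W.+1) + 10 * W + 10 * N + 200 <= M.
  by move: hM; rewrite -/K; lia.
have hM' : (size s).+1 * K + tree_size (code_seq (fun a => code_term (d a)) s) <= M.
  by move: hM => /=; lia.
have {}IH := IH hM'.
move: hM hs; set e := (size s).+1 * K; rewrite /K => hM hs.
apply: wp_runs => /=; size_conds.
eval_call (run_diag (hE a) (gd a) (hW a) hn hn hK).
move=> m1 hm1; size_conds.
eval_call IH; move=> m2 hm2; size_conds; split=> //.
have hB : m1 + 100 <= B by rewrite /B leq_add2r.
rewrite (mulSn (size s).+1 B); clear - hm2 hB; move: hm2 hB; move: (_ * B) => b;
  move: B => b'.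
by clear; lia.
Qed.

End Letters.
End Specs.

(** * Polynomial bounds *)

(** One [k] is both coefficient and exponent, as in the theorem; [0 < s] is there because [0 ^ k]
    vanishes for positive [k]. *)
Definition poly_bounded (p : nat -> nat) : Prop :=
  exists k, forall s, 0 < s -> p s <= k * s ^ k.

Lemma poly_const c : poly_bounded (fun=> c).
Proof.
by exists c => s s0; rewrite -[leqLHS]muln1 leq_mul2l expn_gt0 s0 orbT.
Qed.

Lemma poly_id : poly_bounded id.
Proof. by exists 1 => s _; rewrite mul1n. Qed.

Lemma poly_add p q : poly_bounded p -> poly_bounded q ->
  poly_bounded (fun s => p s + q s).
Proof.
move=> [k hk] [l hl]; exists (k + l) => s s0; rewrite mulnDl.
apply: leq_add.
  by apply: leq_trans (hk s s0) _; rewrite leq_mul2l leq_pexp2l ?leq_addr ?orbT.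
by apply: leq_trans (hl s s0) _; rewrite leq_mul2l leq_pexp2l ?leq_addl ?orbT.
Qed.

Lemma poly_mul p q : poly_bounded p -> poly_bounded q ->
  poly_bounded (fun s => p s * q s).
Proof.
move=> [k hk] [l hl]; exists (k * l + (k + l)) => s s0.
apply: leq_trans (leq_mul (hk s s0) (hl s s0)) _.
rewrite mulnACA -expnD; apply: leq_mul; first exact: leq_addr.
by rewrite leq_pexp2l ?leq_addl.
Qed.

(* Bounds on the weight of a task, on the part of the output that comes from one
   term, on all the values, and on the number of evaluation steps. *)
Definition bound_W (s : nat) : nat := 3 * s + 2 * (s * (8 * s + 50)) + 40.
Definition bound_K (s : nat) : nat :=
  4 * (2 * s * (1 + bound_W s)) + 10 * bound_W s + 10 * (2 * s) + 200.
Definition bound_M (s : nat) : nat :=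
  (s + 3) * bound_K s + s * (8 * s + 50) + 20 * s + 500.
Definition bound_count (s : nat) : nat :=
  (s + 2) * ((bound_W s + 2 * s) * (1000 * bound_M s) + 100) + 220 * s + 105.

Ltac solve_poly := match goal with
  | |- poly_bounded (fun s => @?p s + @?q s) => apply: (@poly_add p q); solve_poly
  | |- poly_bounded (fun s => @?p s * @?q s) => apply: (@poly_mul p q); solve_poly
  | |- poly_bounded (fun s => s) => exact: poly_id
  | |- poly_bounded (fun s => ?c) => exact: (poly_const c)
  end.

Lemma bound_poly : poly_bounded (fun s => bound_count s * bound_M s).
Proof.
rewrite /bound_count /bound_M /bound_K /bound_W; solve_poly.
Qed.

Section Main.
Variables (Sigma Gamma : finType) (T : lam_transducer Sigma Gamma).
Let k := lt_ty T.
Variables (Ei Eo : seq (ledge Gamma)) (Es : Sigma -> seq (ledge Gamma)).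
Variables (ni no : nat) (ns : Sigma -> nat).
Hypothesis hi : reads ni (embed (lt_init T)) [::] (cod k) [::] Ei.
Hypothesis hs : forall a,
  reads (ns a) (embed (lt_step T a)) [::] (LArr (dom k) (cod k)) [::] (Es a).
Hypothesis ho :
  reads no (embed (lt_out T)) [::] (LArr (dom k) (cod TyO)) [::] Eo.
Let s := tree_size (code_lam_transducer T).
Let n := (natoms k).*2.

(** Every type and term is part of the code of size [s], so [bound_W s] covers all the tasks; the
    words have length at most [N = 2 * s], as [natoms k <= s]. *)
Lemma run_main : runs prog (bound_M s) 0 (code_lam_transducer T)
  (Node (code_seq code_sign (alt (natoms k)))
    (Node (code_edges_diag Ei 0 n)
      (Node (code_seq (fun a => code_edges_diag (Es a) n n) (enum Sigma))
        (code_edges_diag Eo n 2))))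
  (bound_count s).
Proof.
have hsz : s = tree_size (code_ty k) + tree_size (code_seq
    (fun a => code_term (lt_step T a)) (enum Sigma)) +
    tree_size (code_term (lt_init T)) + tree_size (code_term (lt_out T)) + 3.
  by rewrite /s /k /code_lam_transducer /=; lia.
have hstep a : tree_size (code_term (lt_step T a)) <= s.
  suff : tree_size (code_term (lt_step T a)) <= tree_size (code_seq
    (fun a => code_term (lt_step T a)) (enum Sigma)) by rewrite hsz; lia.
  have : a \in enum Sigma by rewrite mem_enum.
  by elim: (enum Sigma) => //= b r IH; rewrite inE => /orP[/eqP->|/IH]; lia.
have hcard : size (enum Sigma) < tree_size (code_seq
    (fun a => code_term (lt_step T a)) (enum Sigma)).
  by elim: (enum Sigma) => //= b r IH; lia.
have hk := natoms_code k; have hk2 : n <= 2 * s by rewrite /n; lia.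
have gi := good_embed (lt_initP T); have go := good_embed (lt_outP T).
have gs a := good_embed (lt_stepP T a).
have hlab g : wlty (lmap (pair g) (loc k)) <= s * (8 * s + 50).
  have := @wlty_lab g false k 0 n (leqnn _).
  have : natoms k * (4 * n + 50) <= s * (8 * s + 50) by apply: leq_mul; lia.
  by rewrite /loc; lia.
have [hd hc] := (hlab false, hlab true).
have wi : wtask (embed (lt_init T)) [::] (cod k) [::] <= bound_W s.
  have := wterm_embed (lt_init T); move: hc; rewrite /wtask /bound_W /cod /=.
  by move: (s * _) => q; lia.
have ws a : wtask (embed (lt_step T a)) [::] (LArr (dom k) (cod k)) [::] <=
    bound_W s.
  have := wterm_embed (lt_step T a); have := hstep a; move: hc hd.
  by rewrite /wtask /bound_W /cod /dom /=; move: (s * _) => q; lia.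
have wo : wtask (embed (lt_out T)) [::] (LArr (dom k) (cod TyO)) [::] <=
    bound_W s.
  have := wterm_embed (lt_out T); move: hd.
  by rewrite /wtask /bound_W /cod /dom /=; move: (s * _) => q; lia.
set W := bound_W s in wi ws wo *.
have hK : 4 * (2 * s * W.+1) + 10 * W + 10 * (2 * s) + 200 = bound_K s by [].
have hM : bound_M s = (s + 3) * bound_K s + s * (8 * s + 50) + 20 * s + 500 by [].
have h0 : 0 < s by rewrite hsz addn3.
have hD m : m <= 2 * (2 * s * W.+1) + 3 -> m <= bound_K s.
  by move=> h; apply: leq_trans h _; rewrite -hK; move: (_ * W.+1) => q; lia.
have sz_i : tree_size (code_edges_diag Ei 0 n) <= bound_K s.
  exact/hD/(size_code_diag hi gi.1 wi).
have sz_o : tree_size (code_edges_diag Eo n 2) <= bound_K s.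
  by apply/hD/(size_code_diag ho go.1 wo) => //; lia.
have sz_s : tree_size (code_seq (fun a => code_edges_diag (Es a) n n)
    (enum Sigma)) <= s * bound_K s + 1.
  apply: leq_trans (size_code_diags _ hs (fun a => (gs a).1) ws hk2) _.
  rewrite leq_add2r; apply: leq_mul; first by lia.
  by rewrite -hK; move: (_ * W.+1) => q; lia.
have sgn : tree_size (code_seq code_sign (alt (natoms k))) = 6 * natoms k + 1.
  by elim: (natoms k) => //= m ->; lia.
have hKq : 20 * (s * (8 * s + 50)) + 400 <= bound_K s.
  by rewrite -hK /W /bound_W; move: (s * _) (_ * _.+1) => a b; lia.
have hKM : bound_K s <= bound_M s by rewrite hM; lia.
have hq : natoms k * (4 * (2 * s) + 50) <= s * (8 * s + 50) by apply: leq_mul; lia.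
have hX g : tree_size (code_lty (lmap (pair g) (loc k))) <= s * (8 * s + 50).
  exact: leq_trans (size_code_lty _) (hlab g).
have [sd sc] := (hX false, hX true).
have hn0 := tree_size_code_nat n.
have hM' : (s + 3) * bound_K s = s * bound_K s + 3 * bound_K s by rewrite mulnDl.
have hl g : runs prog (bound_M s) idx_lab
    (Node (code_tag g) (Node Leaf (Node (code_ty k) Leaf)))
    (Node (code_lty (lmap (pair g) (loc k))) (code_nat n))
    (100 * tree_size (code_ty k)).
  have := @run_lab (bound_M s) g false k 0 (2 * s).
  by rewrite lab_snd; apply; [lia|rewrite hM; lia].
have hK' : 4 * (2 * s * W.+1) + 10 * W + 10 * (2 * s) + 200 <= bound_M s.
  by rewrite hK.
have hS : (size (enum Sigma)).+1 *
    (4 * (2 * s * W.+1) + 10 * W + 10 * (2 * s) + 200) +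
    tree_size (code_seq (fun a => code_term (lt_step T a)) (enum Sigma)) <=
    bound_M s.
  rewrite hK; have : (size (enum Sigma)).+1 * bound_K s <= s * bound_K s.
    by apply: leq_mul => //; lia.
  by rewrite hM hM'; move: (_ * bound_K s) (s * bound_K s) => a b; lia.
have n2 : 2 <= 2 * s by lia.
have rd := run_diag hi gi.1 wi (leq0n _) hk2 hK'.
have rs := run_steps hs (fun a => (gs a).1) ws hk2 hS.
have ro := run_diag ho go.1 wo hk2 n2 hK'.
have hcount : (size (enum Sigma)).+1 *
    ((W + 2 * s) * (1000 * bound_M s) + 100) <=
    s * ((W + 2 * s) * (1000 * bound_M s) + 100).
  by apply: leq_mul => //; lia.
have hb : bound_count s = (s + 2) * ((W + 2 * s) * (1000 * bound_M s) + 100) +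
  220 * s + 105 by [].
rewrite mulnDl in hb.
apply: wp_runs => /=; rewrite -/k; size_conds.
eval_call (hl false) => m1 hm1; size_conds.
eval_call (hl true) => m2 hm2; size_conds.
eval_call run_signs; first by rewrite hM; lia.
move=> m3 hm3; size_conds.
eval_call rd => m4 hm4; size_conds.
eval_call rs => m5 hm5; size_conds.
eval_call ro => m6 hm6; size_conds; split=> //.
have {}hm5 := leq_trans hm5 hcount; rewrite hb.
clear - hm1 hm2 hm3 hm4 hm5 hm6 hk hsz; move: hm4 hm5 hm6.
move: (_ * (1000 * _)) => d; move: (s * (d + 100)) => d'; rewrite mulnDr.
by lia.
Qed.

End Main.

Theorem theorem4p7 :
  exists (P : program) (k : nat),
    forall (Sigma Gamma : finType) (T : lam_transducer Sigma Gamma),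
      exists T' : prft Sigma Gamma,
        computes_in_time P (code_lam_transducer T) (code_prft T')
          (k * tree_size (code_lam_transducer T) ^ k) /\
        equivalent T T'.
Proof.
have [k hk] := bound_poly; exists prog, k => Sigma Gamma T.
(* The readings are chosen once: correctness and the run of the program both speak of these
   edges. *)
have [ni [Ei [hi nci [Di eDi]]]] := read_closed (lt_initP T).
have [no [Eo [ho nco [Do eDo]]]] := read_arrow (lt_outP T).
(* Finite choice over the input alphabet. *)
have /fin_all_exists[ns /fin_all_exists[Es hs]] :=
  fun a => read_arrow (lt_stepP T a).
have /fin_all_exists[Ds eDs] : forall a, exists D : transdiag Gamma
    (alt (natoms (lt_ty T))) (alt (natoms (lt_ty T))),
    td_diag D = edges_diag _ _ (Es a).
  by move=> a; case: (hs a).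
have hr a : reads (ns a) (embed (lt_step T a)) [::]
    (LArr (dom (lt_ty T)) (cod (lt_ty T))) [::] (Es a) by case: (hs a).
have ncs a : nc (boundary (alt (natoms (lt_ty T))) (alt (natoms (lt_ty T))))
    (arcs (Es a)) by case: (hs a).
exists (PRFT Di Ds Do); split; last first.
  exact: (prft_equivalent hi hr ho nci ncs nco eDi eDs eDo).
have s0 : 0 < tree_size (code_lam_transducer T) by [].
have [c hc le_c] := run_main hi hr ho.
(* The count of evaluations becomes a cost; the input itself has to fit in [bound_M]. *)
have [|| _ [c' hc' le_c']] := evn_eval hc.
- by rewrite /bound_M addn_gt0 orbT.
- rewrite /= andbT /bound_M.
  by move: (_ * bound_K _) (_ * (8 * _ + _)) => a b; lia.
exists c'; last first.
  apply: leq_trans le_c' (leq_trans _ (hk _ s0)).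
  by rewrite leq_mul2r le_c orbT.
congr (eval _ _ _ _ _): hc'.
rewrite /code_prft /= eDi eDo !code_diag_edges // !size_alt.
congr (Node _ (Node _ (Node _ _))).
by elim: (enum Sigma) => //= a r ->; rewrite eDs code_diag_edges // size_alt.
Qed.
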